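(* Let $b$ be a positive integer and let $g:\mathbb{R}\to\mathbb{R}$ be a periodic field with period $1$, with $|g(x)|\le 1$ for all $x$, and bandlimited in the sense that $$g(x)=\sum_{k=-b}^{b} a[k]\, e^{j2\pi k x},\qquad a[k]=\int_0^1 g(x)e^{-j2\pi kx}\,dx .$$ Let $n>0$ and let $\lambda>1$ be a finite constant independent of $n$. Let $X_1,X_2,\dots$ be i.i.d. positive random variables (inter-sample spacings of a renewal process) with common distribution $X$ satisfying $\mathbb{E}(X)=1/n$ and whose distribution has support in $(0,\lambda/n]$. Let $S_i=X_1+\cdots+X_i$ and let $M$ be the random number of samples in $[0,1]$, i.e. $S_M\le 1<S_{M+1}$. Let $W(x)$ be a measurement-noise process, independent of $(X_i)_{i}$, such that for any distinct points $x_1,\dots,x_l$ the values $W(x_1),\dots,W(x_l)$ are i.i.d. with zero mean and finite variance $\sigma^2$. For $-b\le k\le b$ define $$\widehat{A}_{\mathrm{gen}}[k]:=\frac{1}{M}\sum_{i=1}^{M}\{g(S_i)+W(S_i)\}\exp\!\left(-\frac{j2\pi k i}{M}\right).$$ Then for each $-b\le k\le b$, $$\mathbb{E}\left[\left|\widehat{A}_{\mathrm{gen}}[k]-a[k]\right|^2\right]\le \frac{C}{n},$$ where $C$ is a constant independent of $n$ that depends on the renewal-process parameter $\lambda$ and the bandwidth parameter $b$. Consequently, with $\widehat{G}(x)=\sum_{k=-b}^{b}\widehat{A}_{\mathrm{gen}}[k]e^{j2\pi kx}$, the distortion $$D_{\mathrm{gen}}:=\mathbb{E}\left[\int_0^1|\widehat{G}(x)-g(x)|^2\,dx\right]=\sum_{k=-b}^{b}\mathbb{E}\left[|\widehat{A}_{\mathrm{gen}}[k]-a[k]|^2\right]$$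 satisfies $D_{\mathrm{gen}}\le (2b+1)C/n$, i.e. $D_{\mathrm{gen}}=O(1/n)$.
   Context: $j=\sqrt{-1}$. The sampling locations $S_1,\dots,S_M$ and the distribution of $X$ are unknown to the estimator; only the noisy readings $g(S_1)+W(S_1),\dots,g(S_M)+W(S_M)$ are used. The noise distribution is otherwise unknown. $M$ is a well-defined random variable (stopping rule $X_1+\cdots+X_M\le 1$ and $X_1+\cdots+X_{M+1}>1$).
   Formalization: The constant C may also depend on the noise variance σ², and the noise process W(x) is replaced by the readings W(S_1), W(S_2), …, assumed i.i.d. with zero mean and variance σ² and independent of the spacings. *)

(* Defs.v *)
From HB Require Import structures.
From mathcomp Require Import all_boot all_order all_algebra.
From mathcomp Require Import all_classical all_reals all_analysis.
Set Implicit Arguments. Unset Strict Implicit. Unset Printing Implicit Defensive.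
Import Order.TTheory GRing.Theory Num.Theory.
Import numFieldNormedType.Exports.
Local Open Scope classical_set_scope.
Local Open Scope ring_scope.

Section defs.
Context {d : measure_display} {T : measurableType d} {R : realType}.
Variable P : probability T R.

Definition mutually_independent {I : eqType} (Y : I -> T -> R) : Prop :=
  forall (J : seq I) (B : I -> set R), uniq J -> (forall i, measurable (B i)) ->
  P (\big[setI/setT]_(i <- J) (Y i @^-1` B i)) =
  (\prod_(i <- J) P (Y i @^-1` B i))%E.

Definition identically_distributed {I : Type} (Y : I -> T -> R) : Prop :=
  forall i j (B : set R), measurable B -> P (Y i @^-1` B) = P (Y j @^-1` B).

(** Independence of two families of random variables (of the sigma-algebras
    they generate), stated on the generating pi-systems of finite
    cylinder events. *)
Definition independent_families {I J : Type} (X : I -> T -> R) (Y : J -> T -> R)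
  : Prop :=
  forall (K : seq I) (L : seq J) (A : I -> set R) (B : J -> set R),
  (forall i, measurable (A i)) -> (forall j, measurable (B j)) ->
  P (\big[setI/setT]_(i <- K) (X i @^-1` A i) `&`
     \big[setI/setT]_(j <- L) (Y j @^-1` B j)) =
  (P (\big[setI/setT]_(i <- K) (X i @^-1` A i)) *
   P (\big[setI/setT]_(j <- L) (Y j @^-1` B j)))%E.
End defs.

(** Indices k = -b, ..., b are enumerated as k = i - b for i < 2b+1. *)
Definition kidx (b i : nat) : int := (i%:Z - b%:Z)%R.

Section fourier.
Context {R : realType}.
(** Real and imaginary parts of a[k] = \int_0^1 g(x) e^{-j 2 pi k x} dx. *)
Definition coef_re (g : R -> R) (k : int) : R :=
  Rintegral lebesgue_measure `[0, 1] (fun x => g x * cos (2 * pi * k%:~R * x)).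
Definition coef_im (g : R -> R) (k : int) : R :=
  - Rintegral lebesgue_measure `[0, 1] (fun x => g x * sin (2 * pi * k%:~R * x)).

(** g(x) = \sum_{k=-b}^{b} a[k] e^{j 2 pi k x}, written as real part
    and imaginary part (the latter must vanish since g is real). *)
Definition bandlimited (b : nat) (g : R -> R) : Prop :=
  forall x : R,
    g x = \sum_(i < 2 * b + 1)
            (coef_re g (kidx b i) * cos (2 * pi * (kidx b i)%:~R * x)
             - coef_im g (kidx b i) * sin (2 * pi * (kidx b i)%:~R * x)) /\
    0 = \sum_(i < 2 * b + 1)
            (coef_re g (kidx b i) * sin (2 * pi * (kidx b i)%:~R * x)
             + coef_im g (kidx b i) * cos (2 * pi * (kidx b i)%:~R * x)).

(** Sample locations S_i = X_1 + ... + X_i; in Rocq X is indexed from 0,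
    so S i = X 0 + ... + X (i-1), and S 0 = 0. *)
Definition Ssum {T : Type} (X : nat -> T -> R) (i : nat) (w : T) : R :=
  \sum_(j < i) X j w.

(** Estimator
      A_gen[k] = (1/M) \sum_{i=1}^M (g(S_i) + W(S_i)) exp(-j 2 pi k i / M),
    real and imaginary parts. N i is the noise reading W(S_i) at the i-th
    sample (Rocq index i = 1..M). *)
Definition Ahat_re {T : Type} (g : R -> R) (X N : nat -> T -> R) (M : T -> nat)
    (k : int) (w : T) : R :=
  (M w)%:R^-1 * \sum_(1 <= i < (M w).+1)
     (g (Ssum X i w) + N i w) * cos (2 * pi * k%:~R * i%:R / (M w)%:R).
Definition Ahat_im {T : Type} (g : R -> R) (X N : nat -> T -> R) (M : T -> nat)
    (k : int) (w : T) : R :=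
  - ((M w)%:R^-1 * \sum_(1 <= i < (M w).+1)
     (g (Ssum X i w) + N i w) * sin (2 * pi * k%:~R * i%:R / (M w)%:R)).

Definition sqerr {T : Type} (g : R -> R) (X N : nat -> T -> R) (M : T -> nat)
    (k : int) (w : T) : R :=
  (Ahat_re g X N M k w - coef_re g k) ^+ 2 + (Ahat_im g X N M k w - coef_im g k) ^+ 2.

(** |G_hat(x) - g(x)|^2 with G_hat(x) = \sum_{k=-b}^b A_gen[k] e^{j 2 pi k x}. *)
Definition recon_sqerr {T : Type} (b : nat) (g : R -> R) (X N : nat -> T -> R)
    (M : T -> nat) (w : T) (x : R) : R :=
  (\sum_(i < 2 * b + 1)
     (Ahat_re g X N M (kidx b i) w * cos (2 * pi * (kidx b i)%:~R * x)
      - Ahat_im g X N M (kidx b i) w * sin (2 * pi * (kidx b i)%:~R * x))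
   - g x) ^+ 2 +
  (\sum_(i < 2 * b + 1)
     (Ahat_re g X N M (kidx b i) w * sin (2 * pi * (kidx b i)%:~R * x)
      + Ahat_im g X N M (kidx b i) w * cos (2 * pi * (kidx b i)%:~R * x))) ^+ 2.
End fourier.

(* Main.v *)
(** Split the error of A_gen[k] into a noise part, a jitter part
    (1/M) sum_i (g(S_i) - g(i/M)) e^(-j 2 pi k i/M), and the error of the
    uniform sampling sum, which vanishes as soon as M > 2b.

    Spacings are at most lam/n, so 1/M <= 2 lam/n; given M = m the noise part
    has mean square sigma^2/m.  By the Lipschitz bound on g the jitter is at
    most a multiple of the mean of (S_i - i/M)^2.  With the martingale
    Z_m = sum_{j < m} (X_j - 1/n) 1{S_j <= 1}, stopped when the renewal process
    leaves [0, 1], one has Z_i = S_i - i/n for i <= M + 1, while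
    |M/n - 1| <= |Z_K| + lam/n for every K > M.  Fixing a deterministic K of
    order 2n, both quantities are controlled by E Z_m^2 <= m lam/n^2, and on
    the event M >= K one has Z_K <= -1, so that |Z_K|^2 dominates the (bounded)
    jitter there.  No maximal inequality is needed. *)

Require Import Defs.
From HB Require Import structures.
From mathcomp Require Import all_boot all_order all_algebra.
From mathcomp Require Import all_classical all_reals all_analysis.
From mathcomp Require Import measurable_realfun.
From mathcomp Require Import ring lra zify.
Set Implicit Arguments. Unset Strict Implicit. Unset Printing Implicit Defensive.
Import Order.TTheory GRing.Theory Num.Theory.
Import numFieldNormedType.Exports.
Local Open Scope classical_set_scope.
Local Open Scope ring_scope.

(** * Trigonometric sums and orthogonality *)

Section trigonometric_sums.
Variable R : realType.
Implicit Types (x y t : R) (m k : int).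

(** The obstacle is that the sample count [M] depends on the spacings it counts, so [S_i] for
    [i <= M] is not a sum of independent terms over a fixed range. Stopping moves this dependence
    into an indicator that is known before the next spacing is drawn; expectations are then taken
    only at deterministic indices. The bounds on the spacings are given only almost surely. On
    exceptional paths the sums [S_i] need not increase, several values of [M] may be admissible, and
    [M] may fail to be measurable. The estimate is therefore proved for a modified process that
    obeys the bounds on every path, and is carried back by a comparison of integrals that asks for
    no measurability. All degenerate situations (no sample, at most 2b samples, n < lam) are paid
    for in the same way: lam/n is bounded below there, so crude bounds from |g| <= 1 are already of
    order lam/n. *)

Lemma cos_sin_2pi_int m : cos (2 * pi * m%:~R) = 1 :> R /\ sin (2 * pi * m%:~R) = 0 :> R.
Proof.
have nat_case (n : nat) :
    cos (2 * pi * n%:R) = 1 :> R /\ sin (2 * pi * n%:R) = 0 :> R.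
  elim: n => [|n [IHc IHs]]; first by rewrite mulr0 cos0 sin0.
  rewrite -[n.+1%:R]natr1 mulrDr mulr1 [2 * pi in X in _ + X]mulr_natl.
  by rewrite cosD2pi sinD2pi.
case: m => n; first exact: nat_case.
have [c s] := nat_case n.+1.
by rewrite NegzE mulrNz mulrN cosN sinN c s oppr0.
Qed.

Lemma cos_neq1 t : 0 < `|t| < 2 * pi -> cos t != 1.
Proof.
move=> /andP[t0 t1]; rewrite -cos_norm.
have -> : `|t| = (`|t| / 2) *+ 2 by rewrite -mulr_natl mulrC divfK.
rewrite cos_mulr2n cos2sin2.
have s0 : 0 < sin (`|t| / 2) by apply: sin_gt0_pi; lra.
have : 0 < sin (`|t| / 2) ^+ 2 by rewrite exprn_gt0.
by move=> h; rewrite lt_eqF//; lra.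
Qed.

(* Both sums are invariant under the rotation by [t], which has no nonzero fixed vector. *)
Lemma sum_cos_sin_period t (M : nat) : cos t != 1 ->
  cos (M%:R * t) = 1 -> sin (M%:R * t) = 0 ->
  \sum_(1 <= i < M.+1) cos (i%:R * t) = 0 /\
  \sum_(1 <= i < M.+1) sin (i%:R * t) = 0.
Proof.
move=> t1 cM sM.
set C := \sum_(1 <= i < M.+1) cos _; set S := \sum_(1 <= i < M.+1) sin _.
have shift (f : R -> R) : f (M.+1%:R * t) = f t ->
    \sum_(1 <= i < M.+1) f (i.+1%:R * t) = \sum_(1 <= i < M.+1) f (i%:R * t).
  move=> fM; apply/eqP; rewrite -subr_eq0 -sumrB.
  by rewrite (telescope_sumr (fun i : nat => f (i%:R * t)))// fM mul1r subrr.
have sM1 i : i.+1%:R * t = i%:R * t + t by rewrite -natr1 mulrDl mul1r.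
have eC : C * cos t - S * sin t = C.
  rewrite -[RHS](shift (@cos R)); last by rewrite sM1 cosD cM sM; ring.
  rewrite !mulr_suml -sumrB; apply: eq_bigr => i _.
  by rewrite sM1 cosD.
have eS : S * cos t + C * sin t = S.
  rewrite -[RHS](shift (@sin R)); last by rewrite sM1 sinD cM sM; ring.
  rewrite !mulr_suml -big_split; apply: eq_bigr => i _ /=.
  by rewrite sM1 sinD.
have : C ^+ 2 + S ^+ 2 = 0.
  apply: (mulIf (x := cos t - 1)); first by rewrite subr_eq0.
  rewrite mul0r.
  have -> : (C ^+ 2 + S ^+ 2) * (cos t - 1) =
    C * ((C * cos t - S * sin t) - C) + S * ((S * cos t + C * sin t) - S) by ring.
  by rewrite eC eS; ring.
move/eqP; rewrite paddr_eq0 ?sqr_ge0// !sqrf_eq0.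
by move=> /andP[/eqP -> /eqP ->].
Qed.

(** The condition |m| < M keeps the angle 2 pi m/M strictly between 0 and a full turn in absolute
    value, so its cosine is not 1. *)
Lemma sum_cos_sin_orthogonal m (M : nat) : m != 0 -> (`|m| < M)%N ->
  \sum_(1 <= i < M.+1) cos (i%:R * (2 * pi * m%:~R / M%:R)) = 0 :> R /\
  \sum_(1 <= i < M.+1) sin (i%:R * (2 * pi * m%:~R / M%:R)) = 0 :> R.
Proof.
move=> m0 mM.
have M0 : (0 : R) < M%:R by rewrite ltr0n; lia.
have eM : M%:R * (2 * pi * m%:~R / M%:R) = 2 * pi * m%:~R :> R.
  by field; rewrite gt_eqF.
have [c s] := cos_sin_2pi_int m.
apply: sum_cos_sin_period; rewrite ?eM//.
apply: cos_neq1.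
have pi2 : 0 < 2 * pi :> R by rewrite mulr_gt0// pi_gt0.
rewrite 2!normrM normfV (gtr0_norm pi2) (gtr0_norm M0).
rewrite divr_gt0 ?mulr_gt0 ?normr_gt0 ?intr_eq0//=.
rewrite ltr_pdivrMr// ltr_pM2l// -intr_norm -abszE -pmulrn ltr_nat//.
exact: pi_gt0.
Qed.

Lemma cos_lipschitz x y : `|cos x - cos y| <= `|x - y|.
Proof.
wlog xy : x y / y < x => [hw|].
  have [//||->] := ltgtP x y; last by rewrite !subrr.
    by rewrite distrC (distrC x); exact: hw.
  exact: hw.
have [|c _ ->] := @MVT R (@cos R) (fun x => - sin x) y x xy.
  by apply: continuous_subspaceT => z; exact: continuous_cos.
by rewrite normrM normrN ler_piMl// sin_max.
Qed.

Lemma sin_lipschitz x y : `|sin x - sin y| <= `|x - y|.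
Proof.
rewrite -!cosBpihalf; apply: le_trans (cos_lipschitz _ _) _.
by rewrite opprB addrA subrK.
Qed.

(* [trigp] and [trigq] are the real and imaginary parts of
   sum_l (p_l + j q_l) e^(j phi_l). *)
Definition trigp (n : nat) (p q : 'I_n -> R) (phi : 'I_n -> R) : R :=
  \sum_(l < n) (p l * cos (phi l) - q l * sin (phi l)).
Definition trigq (n : nat) (p q : 'I_n -> R) (phi : 'I_n -> R) : R :=
  \sum_(l < n) (p l * sin (phi l) + q l * cos (phi l)).

Lemma trigp_rotate n (p q phi : 'I_n -> R) t :
  trigp p q phi * cos t + trigq p q phi * sin t = trigp p q (fun l => phi l - t).
Proof.
rewrite !mulr_suml -big_split; apply: eq_bigr => l _ /=.
by rewrite cosB sinB; ring.
Qed.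

Lemma trigq_rotate n (p q phi : 'I_n -> R) t :
  trigq p q phi * cos t - trigp p q phi * sin t = trigq p q (fun l => phi l - t).
Proof.
rewrite !mulr_suml -sumrB; apply: eq_bigr => l _ /=.
by rewrite cosB sinB; ring.
Qed.

(** With F the complex sum and c_k = p_k + j q_k, this is |F|^2 = sum_k Re(conj(c_k) e^(-j phi_k)
    F). It turns a product of sums into sums over phase differences, which integrate term by
    term. *)
Lemma trigp_trigq_sqr n (p q phi : 'I_n -> R) :
  trigp p q phi ^+ 2 + trigq p q phi ^+ 2 =
  \sum_(k < n) (p k * trigp p q (fun l => phi l - phi k)
                + q k * trigq p q (fun l => phi l - phi k)).
Proof.
under eq_bigr do rewrite -trigp_rotate -trigq_rotate.
rewrite !expr2 {1}/trigp {2}/trigq !mulr_suml -big_split /=.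
apply: eq_bigr => k _; rewrite -/(trigq p q phi); ring.
Qed.

End trigonometric_sums.

(** * Integrals of trigonometric functions over one period *)

Lemma Rintegral_sum d (T : measurableType d) (R : realType)
    (mu : {measure set T -> \bar R}) (D : set T) (I : Type) (s : seq I) (F : I -> T -> R) :
  measurable D -> (forall i, mu.-integrable D (EFin \o F i)) ->
  Rintegral mu D (fun x => \sum_(i <- s) F i x) = \sum_(i <- s) Rintegral mu D (F i).
Proof.
move=> mD iF; apply: EFin_inj; rewrite /Rintegral.
under eq_integral do rewrite -sumEFin.
rewrite integral_sum//.
rewrite -EFin_sum_fine; last by move=> i _; exact/integrable_fin_num/iF.
by rewrite fineK//; apply/sum_fin_numP => i _ _; exact/integrable_fin_num/iF.
Qed.

Section integration_on_unit_interval.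
Variable R : realType.
Implicit Types (f g : R -> R) (m : int).
Local Notation mu := (@lebesgue_measure R).

Lemma continuous_integrable01 f : continuous f ->
  mu.-integrable `[0, 1] (EFin \o f).
Proof.
move=> cf; apply: continuous_compact_integrable; first exact: segment_compact.
exact: continuous_subspaceT.
Qed.

Lemma Rintegral01_sum n (F : 'I_n -> R -> R) : (forall i, continuous (F i)) ->
  Rintegral mu `[0, 1] (fun x => \sum_(i < n) F i x) =
  \sum_(i < n) Rintegral mu `[0, 1] (F i).
Proof. by move=> cF; apply: Rintegral_sum => // i; exact: continuous_integrable01. Qed.

Lemma Rintegral01_cos_sin m :
  Rintegral mu `[0, 1] (fun x => cos (2 * pi * m%:~R * x)) = (m == 0)%:R :> R /\
  Rintegral mu `[0, 1] (fun x => sin (2 * pi * m%:~R * x)) = 0 :> R.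
Proof.
have [->|m0] := eqVneq m 0.
  have len : fine (mu `[0, 1]) = 1 :> R.
    by rewrite lebesgue_measure_itv /= lte_fin ltr01 oppr0 adde0.
  split.
    under eq_Rintegral do rewrite mulr0 mul0r cos0.
    by rewrite Rintegral_cst// len mulr1.
  under eq_Rintegral do rewrite mulr0 mul0r sin0.
  by rewrite Rintegral_cst// mul0r.
set c := 2 * pi * m%:~R.
have c0 : c != 0 :> R.
  by rewrite !mulf_neq0 ?intr_eq0// gt_eqF// pi_gt0.
have [cc sc] := @cos_sin_2pi_int R m.
have cl (a : R) : continuous (fun x : R => a * x).
  by move=> x; apply: cvgM; [exact: cvg_cst|exact: cvg_id].
have ftc (f F : R -> R) : continuous f -> continuous F ->
    (forall x, derivable F x 1 /\ 'D_1 F x = f x) ->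
    Rintegral mu `[0, 1] f = F 1 - F 0.
  move=> cf cF dF; rewrite /Rintegral (@continuous_FTC2 _ f F)//.
  - exact: continuous_subspaceT.
  - split.
    + by move=> x _; have [] := dF x.
    + by apply: cvg_at_right_filter; exact: cF.
    + by apply: cvg_at_left_filter; exact: cF.
  - by move=> x _; rewrite derive1E; have [_ ->] := dF x.
have ccos : continuous (fun x => cos (c * x)).
  by move=> x; apply: continuous_comp; [exact: cl|exact: continuous_cos].
have csin : continuous (fun x => sin (c * x)).
  by move=> x; apply: continuous_comp; [exact: cl|exact: continuous_sin].
split.
  rewrite (ftc _ (fun x => c^-1 * sin (c * x)))//.
  - by rewrite mulr1 mulr0 sin0 /c sc /= !mulr0 subrr.
  - by move=> x; apply: continuous_comp; [exact: csin|exact: cl].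
  - move=> x; suff h : is_derive x 1 (fun x : R => c^-1 * sin (c * x) : R) (cos (c * x)) by case: h.
    by apply: is_derive_eq; rewrite /GRing.scale/= mulr1; field; exact: c0.
rewrite (ftc _ (fun x => - c^-1 * cos (c * x)))//.
- by rewrite mulr1 mulr0 cos0 /c cc subrr.
- by move=> x; apply: continuous_comp; [exact: ccos|exact: cl].
- move=> x; suff h : is_derive x 1 (fun x : R => - c^-1 * cos (c * x) : R) (sin (c * x)) by case: h.
    by apply: is_derive_eq; rewrite /GRing.scale/= mulr1; field; exact: c0.
Qed.

End integration_on_unit_interval.

(** * Bandlimited fields *)

Lemma continuous_sum_ord (R : realType) n (F : 'I_n -> R -> R) :
  (forall i, continuous (F i)) -> continuous (fun x => \sum_(i < n) F i x).
Proof.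
move=> cF; apply: continuous_big => [|i _]; last exact: cF.
exact: add_continuous.
Qed.

Section bandlimited_fields.
Variables (R : realType) (b : nat).
Implicit Types (g : R -> R) (u v : 'I_(2 * b + 1) -> R) (k l : 'I_(2 * b + 1)).
Local Notation mu := (@lebesgue_measure R).

Definition phase (x : R) l : R := 2 * pi * (kidx b l)%:~R * x.

Lemma phaseB (x : R) k l :
  phase x l - phase x k = 2 * pi * (kidx b l - kidx b k)%:~R * x.
Proof. by rewrite /phase intrB; ring. Qed.

Lemma kidx_sub_eq0 k l : (kidx b l - kidx b k == 0) = (l == k).
Proof.
rewrite subr_eq0 /kidx; apply/eqP/eqP => [e|-> //].
by apply: ord_inj; lia.
Qed.

Lemma continuous_trigp (m : 'I_(2 * b + 1) -> int) u v :
  continuous (fun x => trigp u v (fun l => 2 * pi * (m l)%:~R * x)).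
Proof.
apply: continuous_sum_ord => l x.
have cl : {for x, continuous (fun y : R => 2 * pi * (m l)%:~R * y)}.
  by apply: cvgM; [exact: cvg_cst|exact: cvg_id].
apply: cvgB; apply: cvgM; (try exact: cvg_cst).
  by apply: continuous_comp => //; exact: continuous_cos.
by apply: continuous_comp => //; exact: continuous_sin.
Qed.

Lemma continuous_trigq (m : 'I_(2 * b + 1) -> int) u v :
  continuous (fun x => trigq u v (fun l => 2 * pi * (m l)%:~R * x)).
Proof.
apply: continuous_sum_ord => l x.
have cl : {for x, continuous (fun y : R => 2 * pi * (m l)%:~R * y)}.
  by apply: cvgM; [exact: cvg_cst|exact: cvg_id].
apply: cvgD; apply: cvgM; (try exact: cvg_cst).
  by apply: continuous_comp => //; exact: continuous_sin.
by apply: continuous_comp => //; exact: continuous_cos.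
Qed.

Lemma Rintegral01_trig (m : 'I_(2 * b + 1) -> int) u v :
  Rintegral mu `[0, 1] (fun x => trigp u v (fun l => 2 * pi * (m l)%:~R * x)) =
    \sum_(l < 2 * b + 1) u l * (m l == 0)%:R /\
  Rintegral mu `[0, 1] (fun x => trigq u v (fun l => 2 * pi * (m l)%:~R * x)) =
    \sum_(l < 2 * b + 1) v l * (m l == 0)%:R.
Proof.
have cl l : continuous (fun y : R => 2 * pi * (m l)%:~R * y).
  by move=> x; apply: cvgM; [exact: cvg_cst|exact: cvg_id].
have cc l (a : R) : continuous (fun y : R => a * cos (2 * pi * (m l)%:~R * y)).
  move=> x; apply: cvgM; first exact: cvg_cst.
  by apply: continuous_comp; [exact: cl|exact: continuous_cos].
have cs l (a : R) : continuous (fun y : R => a * sin (2 * pi * (m l)%:~R * y)).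
  move=> x; apply: cvgM; first exact: cvg_cst.
  by apply: continuous_comp; [exact: cl|exact: continuous_sin].
have cc1 l : continuous (fun y : R => cos (2 * pi * (m l)%:~R * y)).
  by move=> x; apply: continuous_comp; [exact: cl|exact: continuous_cos].
have cs1 l : continuous (fun y : R => sin (2 * pi * (m l)%:~R * y)).
  by move=> x; apply: continuous_comp; [exact: cl|exact: continuous_sin].
rewrite /trigp /trigq; split.
  rewrite Rintegral01_sum; last by move=> l x; apply: cvgB; [exact: cc|exact: cs].
  apply: eq_bigr => l _; have [ic is0] := @Rintegral01_cos_sin R (m l).
  rewrite RintegralB//; [|exact: continuous_integrable01 (cc _ _)|
    exact: continuous_integrable01 (cs _ _)].
  rewrite !RintegralZl//; [|exact: continuous_integrable01 (cs1 _)|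
    exact: continuous_integrable01 (cc1 _)].
  by rewrite ic is0 mulr0 subr0.
rewrite Rintegral01_sum; last by move=> l x; apply: cvgD; [exact: cs|exact: cc].
apply: eq_bigr => l _; have [ic is0] := @Rintegral01_cos_sin R (m l).
rewrite RintegralD//; [|exact: continuous_integrable01 (cs _ _)|
  exact: continuous_integrable01 (cc _ _)].
rewrite !RintegralZl//; [|exact: continuous_integrable01 (cc1 _)|
  exact: continuous_integrable01 (cs1 _)].
by rewrite ic is0 mulr0 add0r.
Qed.

Lemma sum_kidx_eq0 u k :
  \sum_(l < 2 * b + 1) u l * (kidx b l - kidx b k == 0)%:R = u k.
Proof.
rewrite (bigD1 k)//= subrr eqxx mulr1 big1 ?addr0// => l lk.
by rewrite kidx_sub_eq0 (negbTE lk) mulr0.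
Qed.

(** After [trigp_trigq_sqr] every phase has an integer frequency [kidx b l - kidx b k], and
    integration over a period keeps only the diagonal l = k. *)
Lemma parseval u v :
  (\int[mu]_(x in `[0%R, 1%R])
     (trigp u v (phase x) ^+ 2 + trigq u v (phase x) ^+ 2)%:E =
   (\sum_(k < 2 * b + 1) (u k ^+ 2 + v k ^+ 2))%:E)%E.
Proof.
pose F k x := u k * trigp u v (fun l => 2 * pi * (kidx b l - kidx b k)%:~R * x)
            + v k * trigq u v (fun l => 2 * pi * (kidx b l - kidx b k)%:~R * x).
have cp k : continuous (fun x : R =>
    trigp u v (fun l => 2 * pi * (kidx b l - kidx b k)%:~R * x)).
  exact: continuous_trigp.
have cq k : continuous (fun x : R =>
    trigq u v (fun l => 2 * pi * (kidx b l - kidx b k)%:~R * x)).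
  exact: continuous_trigq.
have cF k : continuous (F k).
  by move=> x; apply: cvgD; apply: cvgM; [exact: cvg_cst|exact: cp|exact: cvg_cst|exact: cq].
transitivity (\int[mu]_(x in `[0%R, 1%R]) (\sum_(k < 2 * b + 1) F k x)%:E)%E.
  apply: eq_integral => x _; congr EFin.
  rewrite trigp_trigq_sqr; apply: eq_bigr => k _; rewrite /F.
  have -> : (fun l => phase x l - phase x k) =
      (fun l => 2 * pi * (kidx b l - kidx b k)%:~R * x).
    by apply/funext => l; rewrite phaseB.
  by [].
rewrite -[LHS]fineK; last first.
  apply: integrable_fin_num => //; apply: continuous_integrable01.
  exact: continuous_sum_ord.
congr EFin; transitivity (Rintegral mu `[0, 1] (fun x => \sum_(k < 2 * b + 1) F k x)) => //.
rewrite Rintegral01_sum//; apply: eq_bigr => k _; rewrite /F.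
have ip := continuous_integrable01 (cp k); have iq := continuous_integrable01 (cq k).
have [ep eq] := Rintegral01_trig (fun l => kidx b l - kidx b k) u v.
rewrite RintegralD//; last 2 first.
- apply: continuous_integrable01 => x; apply: cvgM; [exact: cvg_cst|exact: cp].
- apply: continuous_integrable01 => x; apply: cvgM; [exact: cvg_cst|exact: cq].
by rewrite !RintegralZl// ep eq !sum_kidx_eq0 !expr2.
Qed.

Section field.
Variable g : R -> R.
Hypothesis gb : bandlimited b g.
Let p l := coef_re g (kidx b l).
Let q l := coef_im g (kidx b l).

Lemma bandlimited_trigp x : g x = trigp p q (phase x).
Proof. by have [] := gb x. Qed.

Lemma bandlimited_trigq x : trigq p q (phase x) = 0.
Proof. by have [] := gb x. Qed.

Lemma continuous_bandlimited : continuous g.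
Proof.
have -> : g = (fun x => trigp p q (phase x)) by apply/funext => x; exact: bandlimited_trigp.
exact: continuous_trigp.
Qed.

(** The reconstruction error is itself a trigonometric polynomial, whose coefficients are the errors
    of the estimates; Parseval then gives equality on each path separately. *)
Lemma integral_recon_sqerr (T : Type) (X N : nat -> T -> R) (M : T -> nat) (w : T) :
  (\int[mu]_(x in `[0%R, 1%R]) (recon_sqerr b g X N M w x)%:E =
   (\sum_(i < 2 * b + 1) sqerr g X N M (kidx b i) w)%:E)%E.
Proof.
rewrite -(parseval (fun l => Ahat_re g X N M (kidx b l) w - p l)
                   (fun l => Ahat_im g X N M (kidx b l) w - q l)).
apply: eq_integral => x _; congr EFin; rewrite /recon_sqerr; congr (_ ^+ 2 + _ ^+ 2).
  rewrite {1}bandlimited_trigp /trigp -sumrB; apply: eq_bigr => l _.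
  by rewrite /phase; ring.
rewrite -[LHS]subr0 -{2}(bandlimited_trigq x) /trigq -sumrB; apply: eq_bigr => l _.
by rewrite /phase; ring.
Qed.

(** Two frequencies in [-b, b] differ by at most 2b < M, so uniform sampling does not alias them and
    discrete orthogonality isolates the k-th coefficient. Since g is real, multiplying it by a
    cosine or sine amounts to rotating its complex expansion by the k-th phase. *)
Lemma sample_mean_fourier k (M : nat) : (2 * b < M)%N ->
  M%:R^-1 * \sum_(1 <= i < M.+1)
      g (i%:R / M%:R) * cos (2 * pi * (kidx b k)%:~R * i%:R / M%:R) = p k /\
  - (M%:R^-1 * \sum_(1 <= i < M.+1)
      g (i%:R / M%:R) * sin (2 * pi * (kidx b k)%:~R * i%:R / M%:R)) = q k.
Proof.
move=> bM.
have M0 : M%:R != 0 :> R by rewrite pnatr_eq0; lia.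
pose c l := \sum_(1 <= i < M.+1) cos (phase (i%:R / M%:R) l - phase (i%:R / M%:R) k).
pose s l := \sum_(1 <= i < M.+1) sin (phase (i%:R / M%:R) l - phase (i%:R / M%:R) k).
have cE l : c l = M%:R * (kidx b l - kidx b k == 0)%:R /\ s l = 0.
  rewrite kidx_sub_eq0; have [->|lk] := eqVneq l k.
    rewrite /c /s; under eq_bigr do rewrite subrr cos0.
    split; last by rewrite big1// => i _; rewrite subrr sin0.
    by rewrite sumr_const_nat subSS subn0 mulr1.
  have [||h1 h2] := @sum_cos_sin_orthogonal R (kidx b l - kidx b k) M.
  - by rewrite kidx_sub_eq0.
  - by move: (ltn_ord l) (ltn_ord k); rewrite /kidx; lia.
  rewrite mulr0; split; [rewrite -h1|rewrite -h2];
    by apply: eq_bigr => i _; rewrite phaseB; congr (_ _); field.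
have ph i : 2 * pi * (kidx b k)%:~R * i%:R / M%:R = phase (i%:R / M%:R) k.
  by rewrite /phase mulrA.
split.
  have -> : \sum_(1 <= i < M.+1) g (i%:R / M%:R) *
      cos (2 * pi * (kidx b k)%:~R * i%:R / M%:R) =
      \sum_(l < 2 * b + 1) (p l * c l - q l * s l).
    under [RHS]eq_bigr do rewrite !mulr_sumr -sumrB.
    rewrite exchange_big; apply: eq_bigr => i _ /=; rewrite ph.
    rewrite -[RHS]/(trigp p q (fun l => phase (i%:R / M%:R) l - phase (i%:R / M%:R) k)).
    by rewrite -trigp_rotate bandlimited_trigq mul0r addr0 -bandlimited_trigp.
  rewrite -[RHS](sum_kidx_eq0 p) mulr_sumr; apply: eq_bigr => l _.
  by have [-> ->] := cE l; field.
have -> : \sum_(1 <= i < M.+1) g (i%:R / M%:R) *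
    sin (2 * pi * (kidx b k)%:~R * i%:R / M%:R) =
    - \sum_(l < 2 * b + 1) (p l * s l + q l * c l).
  under [in RHS]eq_bigr do rewrite !mulr_sumr -big_split/=.
  rewrite exchange_big -sumrN; apply: eq_bigr => i _ /=; rewrite ph.
  rewrite -[X in - X]/(trigq p q (fun l => phase (i%:R / M%:R) l - phase (i%:R / M%:R) k)).
  by rewrite -trigq_rotate bandlimited_trigq mul0r add0r opprK -bandlimited_trigp.
rewrite -[RHS](sum_kidx_eq0 q) mulrN opprK mulr_sumr; apply: eq_bigr => l _.
by have [-> ->] := cE l; field.
Qed.

Hypothesis g1 : forall x, `|g x| <= 1.

Lemma norm_Rintegral01_le1 (f : R -> R) : continuous f -> (forall x, `|f x| <= 1) ->
  `|Rintegral mu `[0, 1] f| <= 1.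
Proof.
move=> cf f1.
have len : fine (mu `[0, 1]) = 1 :> R.
  by rewrite lebesgue_measure_itv /= lte_fin ltr01 oppr0 adde0.
apply: le_trans (le_normr_Rintegral _ _) _ => //; first exact: continuous_integrable01.
apply: (@le_trans _ _ (Rintegral mu `[0, 1] (fun=> 1 : R))); last first.
  by rewrite Rintegral_cst// len mulr1.
apply: le_Rintegral => //.
- apply: (@continuous_integrable01 _ (fun x => `|f x|)) => x.
  by apply: continuous_comp; [exact: cf|exact: norm_continuous].
- by apply: (@continuous_integrable01 _ (fun=> 1)) => x; exact: cvg_cst.
Qed.

Lemma coef_le1 (m : int) : `|coef_re g m| <= 1 /\ `|coef_im g m| <= 1.
Proof.
have cl : continuous (fun y : R => 2 * pi * m%:~R * y).
  by move=> x; apply: cvgM; [exact: cvg_cst|exact: cvg_id].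
rewrite /coef_re /coef_im normrN; split; apply: norm_Rintegral01_le1.
- move=> x; apply: cvgM; first exact: continuous_bandlimited.
  by apply: continuous_comp; [exact: cl|exact: continuous_cos].
- by move=> x; rewrite normrM mulr_ile1// cos_max.
- move=> x; apply: cvgM; first exact: continuous_bandlimited.
  by apply: continuous_comp; [exact: cl|exact: continuous_sin].
- by move=> x; rewrite normrM mulr_ile1// sin_max.
Qed.

(** There are 2b+1 frequencies, each with a cosine and a sine term of slope at most 2 pi b, because
    the coefficients are at most 1 in absolute value. *)
Definition field_lipschitz : R := (2 * b + 1)%:R * (4 * pi * b%:R).

Lemma bandlimited_lipschitz x y : `|g x - g y| <= field_lipschitz * `|x - y|.
Proof.
rewrite !bandlimited_trigp /trigp -sumrB.
apply: le_trans (ler_norm_sum _ _ _) _.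
rewrite /field_lipschitz -mulrA mulr_natl -[X in _ *+ X]card_ord -sumr_const.
apply: ler_sum => l _.
have [p1 q1] := coef_le1 (kidx b l).
have ph : `|phase x l - phase y l| <= 2 * pi * b%:R * `|x - y|.
  rewrite /phase -mulrBr normrM ler_wpM2r// normrM ger0_norm; last first.
    by rewrite mulr_ge0// pi_ge0.
  rewrite ler_wpM2l ?mulr_ge0 ?pi_ge0//.
  rewrite -intr_norm -abszE -pmulrn ler_nat /kidx; move: (ltn_ord l); lia.
have -> : p l * cos (phase x l) - q l * sin (phase x l) -
    (p l * cos (phase y l) - q l * sin (phase y l)) =
    p l * (cos (phase x l) - cos (phase y l)) - q l * (sin (phase x l) - sin (phase y l)).
  by ring.
apply: le_trans (ler_normB _ _) _; rewrite !normrM.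
have h1 : `|p l| * `|cos (phase x l) - cos (phase y l)| <= 2 * pi * b%:R * `|x - y|.
  rewrite -[leRHS]mul1r ler_pM//; apply: le_trans ph; exact: cos_lipschitz.
have h2 : `|q l| * `|sin (phase x l) - sin (phase y l)| <= 2 * pi * b%:R * `|x - y|.
  rewrite -[leRHS]mul1r ler_pM//; apply: le_trans ph; exact: sin_lipschitz.
lra.
Qed.

End field.
End bandlimited_fields.

(** * Error along a sample path *)

Section pathwise_error.
Variable R : realType.

Lemma sqr_add3_le (x y z : R) : (x + y + z) ^+ 2 <= 3 * x ^+ 2 + 3 * y ^+ 2 + 3 * z ^+ 2.
Proof.
have -> : 3 * x ^+ 2 + 3 * y ^+ 2 + 3 * z ^+ 2 =
  (x + y + z) ^+ 2 + ((x - y) ^+ 2 + (y - z) ^+ 2 + (z - x) ^+ 2) by ring.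
by rewrite lerDl !addr_ge0// sqr_ge0.
Qed.

Lemma sqr_le_of_norm (x y : R) : `|x| <= y -> x ^+ 2 <= y ^+ 2.
Proof. by rewrite ler_norml => /andP[? ?]; nra. Qed.

(** Nonnegativity of the empirical variance. For [M = 0] both sides are 0, as [0^-1 = 0]. *)
Lemma sqr_mean_le (M : nat) (f : nat -> R) :
  (M%:R^-1 * \sum_(1 <= i < M.+1) f i) ^+ 2 <=
  M%:R^-1 * \sum_(1 <= i < M.+1) f i ^+ 2.
Proof.
have [->|M0] := eqVneq M 0%N; first by rewrite invr0 !mul0r expr2 mul0r.
have M0' : 0 < M%:R :> R by rewrite ltr0n lt0n.
set s := \sum_(1 <= i < M.+1) f i; set a := M%:R^-1 * s.
have sE : s = M%:R * a by rewrite /a mulrA divff ?mul1r// gt_eqF.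
have : 0 <= \sum_(1 <= i < M.+1) (f i - a) ^+ 2 by apply: sumr_ge0 => i _; exact: sqr_ge0.
have -> : \sum_(1 <= i < M.+1) (f i - a) ^+ 2 =
    \sum_(1 <= i < M.+1) f i ^+ 2 - 2 * a * s + M%:R * a ^+ 2.
  under eq_bigr do rewrite sqrrB.
  rewrite big_split sumrB /= sumr_const_nat subSS subn0 [M%:R * _]mulr_natl.
  congr (_ - _ + _); rewrite /s mulr_sumr; apply: eq_bigr => i _.
  by rewrite -mulr_natl; ring.
rewrite sE => h; rewrite ler_pdivlMl//; lra.
Qed.

Variables (T : Type) (X : nat -> T -> R).

Lemma SsumS i w : Ssum X i.+1 w = Ssum X i w + X i w.
Proof. by rewrite /Ssum big_ord_recr. Qed.

(* The centred renewal process, frozen once it has left [0, 1]. *)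
Definition stopped (n : R) (m : nat) (w : T) : R :=
  \sum_(j < m) (X j w - n^-1) * (Ssum X j w <= 1)%R%:R.

Lemma stoppedS n m w :
  stopped n m.+1 w = stopped n m w + (X m w - n^-1) * (Ssum X m w <= 1)%R%:R.
Proof. by rewrite /stopped big_ord_recr. Qed.

(** Squared modulus of the averaged noise; the sign of the exponent is lost in the square. The count
    [m] is a free number, so that the expectation can be taken at fixed [m] before [M w] is put in
    its place. *)
Definition noise_sqr (N : nat -> T -> R) (k : int) (m : nat) (w : T) : R :=
  (m%:R^-1 * \sum_(1 <= i < m.+1) N i w * cos (2 * pi * k%:~R * i%:R / m%:R)) ^+ 2 +
  (m%:R^-1 * \sum_(1 <= i < m.+1) N i w * sin (2 * pi * k%:~R * i%:R / m%:R)) ^+ 2.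

Section path.
Variables (n lam : R) (M : T -> nat) (w : T).
Hypotheses (n0 : 0 < n) (lam1 : 1 < lam).
Hypothesis Xb : forall i, 0 < X i w <= lam / n.
Hypothesis HM : Ssum X (M w) w <= 1 < Ssum X (M w).+1 w.

Lemma Ssum_homo i j : (i <= j)%N -> Ssum X i w <= Ssum X j w.
Proof.
move=> /subnKC <-; elim: (j - i)%N => [|k IH]; first by rewrite addn0.
by rewrite addnS SsumS; have /andP[] := Xb (i + k); lra.
Qed.

Lemma Ssum_le i : Ssum X i w <= i%:R * (lam / n).
Proof.
elim: i => [|i IH]; first by rewrite /Ssum big_ord0 mul0r.
by rewrite SsumS -natr1 mulrDl mul1r lerD//; have /andP[] := Xb i.
Qed.

Lemma rate_lt_samples : n < (M w).+1%:R * lam.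
Proof.
have /andP[_ h] := HM; have := lt_le_trans h (Ssum_le (M w).+1).
by rewrite mulrA ltr_pdivlMr// mul1r.
Qed.

Lemma inv_samples_le : (M w)%:R^-1 <= 2 * (lam / n).
Proof.
have n0' := n0; have lam1' := lam1.
have [->|M0] := eqVneq (M w) 0%N.
  by rewrite invr0 mulr_ge0// divr_ge0//; lra.
have M1 : 1 <= (M w)%:R :> R by rewrite ler1n lt0n.
rewrite mulrA ler_pdivlMr// ler_pdivrMl; last lra.
have := rate_lt_samples; rewrite -natr1; nra.
Qed.

(** The indicator tests the sum before the j-th spacing is added, so the spacing that crosses 1
    still counts and the range reaches [(M w).+1]. *)
Lemma stopped_before i : (i <= (M w).+1)%N -> stopped n i w = Ssum X i w - i%:R / n.
Proof.
move=> iM; rewrite /stopped /Ssum.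
have -> : i%:R / n = \sum_(j < i) n^-1 by rewrite sumr_const card_ord mulr_natl.
rewrite -sumrB; apply: eq_bigr => j _.
have -> : Ssum X j w <= 1; last by rewrite mulr1.
have /andP[h _] := HM; apply: le_trans h.
by apply: Ssum_homo; rewrite -ltnS (leq_trans _ iM).
Qed.

(** Every later increment carries a vanishing indicator. This is what lets a deterministic index
    replace the random index [(M w).+1]. *)
Lemma stopped_after i : (M w < i)%N -> stopped n i w = stopped n (M w).+1 w.
Proof.
move=> /subnKC <-; elim: (i - (M w).+1)%N => [|k IH]; first by rewrite addn0.
rewrite addnS stoppedS IH.
have -> : (Ssum X ((M w).+1 + k)%N w <= 1) = false; last by rewrite mulr0 addr0.
apply/negbTE; rewrite -ltNge; have /andP[_ h] := HM; apply: lt_le_trans h _.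
exact/Ssum_homo/leq_addr.
Qed.

(** With r = i/M and Z the stopped process, S_i - i/M = Z_i - r Z_{M+1} + r e exactly, where 0 <= r
    <= 1 and Z_{M+1} = Z_K. *)
Lemma sample_deviation (K i : nat) : (M w < K)%N -> (i <= M w)%N -> (0 < i)%N ->
  (Ssum X i w - i%:R / (M w)%:R) ^+ 2 <=
  3 * stopped n i w ^+ 2 + 3 * stopped n K w ^+ 2 + 3 * (lam / n) ^+ 2.
Proof.
have n0' := n0; have lam1' := lam1.
move=> MK iM i0.
have M0 : 0 < (M w)%:R :> R by rewrite ltr0n (leq_trans i0).
pose r := i%:R / (M w)%:R : R.
have r0 : 0 <= r by rewrite divr_ge0.
have r1 : r <= 1 by rewrite ler_pdivrMr// mul1r ler_nat.
have rr : r ^+ 2 <= 1 by rewrite expr_le1.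
(* Overshoot of the level 1 minus the mean spacing. Both lie between 0 and lam/n, hence so does
   |e|. *)
pose e := Ssum X (M w).+1 w - 1 - n^-1.
have eb : e ^+ 2 <= (lam / n) ^+ 2.
  have /andP[h1 h2] := HM; have /andP[_ h3] := Xb (M w).
  have n1 : 0 < n^-1 by rewrite invr_gt0.
  have nl : n^-1 <= lam / n by rewrite ler_peMl// ltW.
  apply: sqr_le_of_norm; rewrite ler_norml.
  by move: h2; rewrite /e SsumS => h2; apply/andP; split; lra.
have -> : Ssum X i w - i%:R / (M w)%:R = stopped n i w + (- r * stopped n K w) + r * e.
  rewrite (stopped_after MK) !stopped_before//; last exact: leqW.
  rewrite /e /r -natr1; field.
  by rewrite !gt_eqF.
apply: le_trans (sqr_add3_le _ _ _) _; rewrite [(- r * _) ^+ 2]exprMn sqrrN [(r * e) ^+ 2]exprMn.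
have h1 : r ^+ 2 * stopped n K w ^+ 2 <= stopped n K w ^+ 2 by rewrite ler_piMl// sqr_ge0.
have h2 : r ^+ 2 * e ^+ 2 <= e ^+ 2 by rewrite ler_piMl// sqr_ge0.
lra.
Qed.

Lemma stopped_late (K : nat) : 2 * n <= K%:R -> (K <= M w)%N -> 1 <= stopped n K w ^+ 2.
Proof.
have n0' := n0; have lam1' := lam1.
move=> nK KM; rewrite stopped_before ?leqW//.
have h1 : Ssum X K w <= 1 by have /andP[h _] := HM; apply: le_trans h; exact: Ssum_homo.
have h2 : 2 <= K%:R / n by rewrite ler_pdivlMr.
nra.
Qed.

Variables (b : nat) (g : R -> R).
Hypotheses (gb : bandlimited b g) (g1 : forall x, `|g x| <= 1).
Let L := field_lipschitz R b.

(* For n < lam the jitter is at most 4 <= 4 lam/n. *)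
Definition jitter_bound (K : nat) : R :=
  if n < lam then 0 else
  L ^+ 2 * (6 * (lam / n) * \sum_(i < K.+1) stopped n i w ^+ 2 + 3 * stopped n K w ^+ 2)
  + 4 * stopped n K w ^+ 2.

(** Three regimes. If n < lam, or if [K <= M w], the crude bound 4 on a squared difference of values
    of g is absorbed by 4 lam/n or by four times the squared stopped process at K. Otherwise the
    Lipschitz bound and [sample_deviation] apply, and 6 is the 3 of the latter times the 2 of
    [inv_samples_le]. *)
Lemma mean_jitter_le (K : nat) : 2 * n <= K%:R ->
  (M w)%:R^-1 * \sum_(1 <= i < (M w).+1)
      (g (Ssum X i w) - g (i%:R / (M w)%:R)) ^+ 2
  <= jitter_bound K + (3 * L ^+ 2 + 4) * (lam / n).
Proof.
have n0' := n0; have lam1' := lam1.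
move=> nK.
have ln0 : 0 < lam / n by rewrite divr_gt0//; lra.
have L2 : 0 <= L ^+ 2 by exact: sqr_ge0.
have Z2 : 0 <= stopped n K w ^+ 2 by exact: sqr_ge0.
have sZ : 0 <= \sum_(i < K.+1) stopped n i w ^+ 2.
  by apply: sumr_ge0 => i _; exact: sqr_ge0.
have mean_le (f : nat -> R) c : (forall i, (0 < i <= M w)%N -> f i <= c) -> 0 <= c ->
    (M w)%:R^-1 * \sum_(1 <= i < (M w).+1) f i <= c.
  move=> fc c0; have [->|M0] := eqVneq (M w) 0%N; first by rewrite invr0 mul0r.
  rewrite ler_pdivrMl ?ltr0n ?lt0n// -[X in _ <= X * _]/((M w)%:R).
  apply: (@le_trans _ _ (\sum_(1 <= i < (M w).+1) c)).
    by rewrite big_nat [leRHS]big_nat; apply: ler_sum => i iM; exact: fc.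
  by rewrite sumr_const_nat subSS subn0 mulr_natl.
have d4 i : (g (Ssum X i w) - g (i%:R / (M w)%:R)) ^+ 2 <= 4.
  have := g1 (Ssum X i w); have := g1 (i%:R / (M w)%:R); rewrite !ler_norml; nra.
have [nlam|nlam] := ltP n lam.
  have h : 1 <= lam / n by rewrite ler_pdivlMr// mul1r ltW.
  have h4 : (M w)%:R^-1 * \sum_(1 <= i < (M w).+1)
      (g (Ssum X i w) - g (i%:R / (M w)%:R)) ^+ 2 <= 4.
    by apply: mean_le => // i _.
  rewrite /jitter_bound nlam; nra.
(* This reduces the term (lam/n)^2 of [sample_deviation] to first order in lam/n. *)
have h : lam / n <= 1 by rewrite ler_pdivrMr// mul1r.
have J0 : 4 * stopped n K w ^+ 2 <= jitter_bound K.
  by rewrite /jitter_bound ltNge nlam lerDr mulr_ge0// addr_ge0// mulr_ge0// mulr_ge0// ltW.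
have [KM|MK] := leqP K (M w).
  have h1 := stopped_late nK KM.
  have h4 : (M w)%:R^-1 * \sum_(1 <= i < (M w).+1)
      (g (Ssum X i w) - g (i%:R / (M w)%:R)) ^+ 2 <= 4.
    by apply: mean_le => // i _.
  nra.
have -> : jitter_bound K + (3 * L ^+ 2 + 4) * (lam / n) =
  2 * (lam / n) * (3 * L ^+ 2 * \sum_(i < K.+1) stopped n i w ^+ 2) +
  (L ^+ 2 * (3 * stopped n K w ^+ 2 + 3 * (lam / n)) +
   4 * (stopped n K w ^+ 2 + lam / n)).
  by rewrite /jitter_bound ltNge nlam /=; field; rewrite gt_eqF.
apply: (@le_trans _ _ ((M w)%:R^-1 * \sum_(1 <= i < (M w).+1)
   (3 * L ^+ 2 * stopped n i w ^+ 2 +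
     L ^+ 2 * (3 * stopped n K w ^+ 2 + 3 * (lam / n))))).
  rewrite ler_wpM2l ?invr_ge0// big_nat [leRHS]big_nat.
  apply: ler_sum => i /andP[i0 iM].
  apply: (@le_trans _ _ (L ^+ 2 * (Ssum X i w - i%:R / (M w)%:R) ^+ 2)).
    rewrite -[X in L ^+ 2 * X]real_normK ?num_real// -exprMn.
    exact/sqr_le_of_norm/bandlimited_lipschitz.
  have := sample_deviation MK iM i0.
  have : (lam / n) ^+ 2 <= lam / n by nra.
  nra.
rewrite big_split mulrDr /=; apply: lerD.
  apply: ler_pM; rewrite ?invr_ge0 ?inv_samples_le//.
    by apply: sumr_ge0 => i _; rewrite mulr_ge0 ?sqr_ge0// mulr_ge0.
  rewrite -mulr_sumr ler_wpM2l ?(mulr_ge0 _ L2)//.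
  (* The random range 1..M is enlarged by nonnegative terms to the deterministic range 0..K. *)
  have <- := @big_mkord _ 0 +%R K.+1 xpredT (fun i => stopped n i w ^+ 2).
  have MK1 := leqW MK.
  rewrite (@big_cat_nat R 0 +%R 1%N 0%N K.+1 xpredT)//=.
  rewrite (@big_cat_nat R 0 +%R (M w).+1 1%N K.+1 xpredT _ _ MK1)//=.
  by rewrite addrCA lerDl addr_ge0//; apply: sumr_ge0 => i _; exact: sqr_ge0.
apply: le_trans (mean_le _ (L ^+ 2 * (3 * stopped n K w ^+ 2 + 3 * (lam / n))) _ _) _ => //.
  by rewrite mulr_ge0// addr_ge0// mulr_ge0// ltW.
by rewrite lerDl mulr_ge0// addr_ge0// ltW.
Qed.

(** Three times the constant 3 L^2 + 4 of [mean_jitter_le], three times the sampling error 8 (2b+1)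
    for few samples, and 2 for a path with no sample. The factor 3 comes from squaring a sum of
    three parts. *)
Definition sqerr_const : R := 9 * L ^+ 2 + 12 + 24 * (2 * b + 1)%:R + 2.

Lemma sqerr_le (N : nat -> T -> R) (K : nat) (k : 'I_(2 * b + 1)) : 2 * n <= K%:R ->
  sqerr g X N M (kidx b k) w <=
  3 * noise_sqr N (kidx b k) (M w) w + 3 * jitter_bound K + sqerr_const * (lam / n).
Proof.
have n0' := n0; have lam1' := lam1.
move=> nK.
have ln0 : 0 < lam / n by rewrite divr_gt0//; lra.
have L2 : 0 <= L ^+ 2 by exact: sqr_ge0.
have b0 : 0 <= (2 * b + 1)%:R :> R by [].
have J0 : 0 <= jitter_bound K.
  have sZ : 0 <= \sum_(i < K.+1) stopped n i w ^+ 2.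
    by apply: sumr_ge0 => i _; exact: sqr_ge0.
  have Z2 : 0 <= stopped n K w ^+ 2 by exact: sqr_ge0.
  by rewrite /jitter_bound; case: ifP => // _; rewrite addr_ge0// mulr_ge0// addr_ge0// mulr_ge0// mulr_ge0// ltW.
have noise0 : 0 <= noise_sqr N (kidx b k) (M w) w by rewrite addr_ge0// sqr_ge0.
have [p1 q1] := coef_le1 gb g1 (kidx b k).
have nM := rate_lt_samples.
have [M0|M0] := eqVneq (M w) 0%N.
  (* Without samples the estimate is 0, as [0^-1 = 0], so the error is |a[k]|^2 <= 2, while
     [rate_lt_samples] reads n < lam. *)
  have h : 1 <= lam / n by move: nM; rewrite M0 mul1r => nM; rewrite ler_pdivlMr// mul1r ltW.
  move: (noise_sqr _ _ _ _) noise0 => ns ns0.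
  rewrite /sqerr /Ahat_re /Ahat_im M0 invr0 !mul0r oppr0 !sub0r.
  rewrite (sqrrN (coef_re _ _)) (sqrrN (coef_im _ _)).
  have : coef_re g (kidx b k) ^+ 2 <= 1 by move: p1; rewrite ler_norml; nra.
  have : coef_im g (kidx b k) ^+ 2 <= 1 by move: q1; rewrite ler_norml; nra.
  have c2 : 2 <= sqerr_const by rewrite /sqerr_const; lra.
  have : sqerr_const <= sqerr_const * (lam / n) by rewrite ler_peMr//; lra.
  lra.
have M1 : 1 <= (M w)%:R :> R by rewrite ler1n lt0n.
pose ct i : R := cos (2 * pi * (kidx b k)%:~R * i%:R / (M w)%:R).
pose st i : R := sin (2 * pi * (kidx b k)%:~R * i%:R / (M w)%:R).
pose avg (f : nat -> R) := (M w)%:R^-1 * \sum_(1 <= i < (M w).+1) f i.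
pose d i := g (Ssum X i w) - g (i%:R / (M w)%:R).
pose gm i := g (i%:R / (M w)%:R).
have avgD f h : avg (fun i => f i + h i) = avg f + avg h.
  by rewrite /avg big_split mulrDr.
have reE : Ahat_re g X N M (kidx b k) w - coef_re g (kidx b k) =
    avg (fun i => N i w * ct i) + avg (fun i => d i * ct i) +
    (avg (fun i => gm i * ct i) - coef_re g (kidx b k)).
  rewrite addrA -!avgD; congr (_ - _); rewrite /Ahat_re /avg; congr (_ * _).
  by apply: eq_bigr => i _; rewrite /d /gm -/(ct i); ring.
have imE : Ahat_im g X N M (kidx b k) w - coef_im g (kidx b k) =
    - (avg (fun i => N i w * st i)) + (- avg (fun i => d i * st i)) +
    (- avg (fun i => gm i * st i) - coef_im g (kidx b k)).
  have -> : Ahat_im g X N M (kidx b k) w =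
      - avg (fun i => N i w * st i + d i * st i + gm i * st i).
    rewrite /Ahat_im /avg; congr (- (_ * _)).
    by apply: eq_bigr => i _; rewrite /d /gm -/(st i); ring.
  by rewrite !avgD; ring.
have noiseE : noise_sqr N (kidx b k) (M w) w =
    avg (fun i => N i w * ct i) ^+ 2 + avg (fun i => N i w * st i) ^+ 2 by [].
have jit : avg (fun i => d i * ct i) ^+ 2 + avg (fun i => d i * st i) ^+ 2 <=
    jitter_bound K + (3 * L ^+ 2 + 4) * (lam / n).
  apply: le_trans (mean_jitter_le nK).
  apply: (@le_trans _ _ (avg (fun i => (d i * ct i) ^+ 2) + avg (fun i => (d i * st i) ^+ 2))).
    by apply: lerD; exact: sqr_mean_le.
  rewrite -avgD /avg; rewrite le_eqVlt; apply/orP; left; apply/eqP; congr (_ * _).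
  by apply: eq_bigr => i _; rewrite !exprMn -mulrDr cos2Dsin2 mulr1.
have alias : (avg (fun i => gm i * ct i) - coef_re g (kidx b k)) ^+ 2 +
    (- avg (fun i => gm i * st i) - coef_im g (kidx b k)) ^+ 2 <=
    8 * (2 * b + 1)%:R * (lam / n).
  have [Mb|bM] := leqP (M w) (2 * b); last first.
    have [re im] := sample_mean_fourier gb k bM.
    have -> : avg (fun i => gm i * ct i) = coef_re g (kidx b k) by exact: re.
    have -> : - avg (fun i => gm i * st i) = coef_im g (kidx b k) by exact: im.
    by rewrite !subrr expr0n addr0 mulr_ge0 ?(ltW ln0)// mulr_ge0.
  (* At most 2b samples force n < (2b+1) lam, so even a bounded error is of order lam/n. *)
  have h : 1 <= (2 * b + 1)%:R * (lam / n).
    rewrite mulrA ler_pdivlMr// mul1r; apply: le_trans (ltW nM) _.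
    by apply: ler_wpM2r; [lra|rewrite ler_nat addn1 ltnS].
  have avg1 f : (forall i, `|f i| <= 1) -> `|avg f| <= 1.
    move=> f1; rewrite /avg normrM ger0_norm ?invr_ge0// ler_pdivrMl; last lra.
    apply: le_trans (ler_norm_sum _ _ _) _.
    apply: (@le_trans _ _ (\sum_(1 <= i < (M w).+1) 1)); first exact: ler_sum.
    by rewrite sumr_const_nat subSS subn0 mulr1.
  have gc : `|avg (fun i => gm i * ct i)| <= 1.
    by apply: avg1 => i; rewrite normrM; apply: (mulr_ile1 _ _ (g1 _) (cos_max _)).
  have gs : `|avg (fun i => gm i * st i)| <= 1.
    by apply: avg1 => i; rewrite normrM; apply: (mulr_ile1 _ _ (g1 _) (sin_max _)).
  move: gc gs p1 q1; rewrite !ler_norml => /andP[? ?] /andP[? ?] /andP[? ?] /andP[? ?].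
  have h1 : (avg (fun i => gm i * ct i) - coef_re g (kidx b k)) ^+ 2 <= 4.
    rewrite (_ : 4 = 2 ^+ 2); last ring.
    by apply: sqr_le_of_norm; rewrite ler_norml; apply/andP; split; lra.
  have h2 : (- avg (fun i => gm i * st i) - coef_im g (kidx b k)) ^+ 2 <= 4.
    rewrite (_ : 4 = 2 ^+ 2); last ring.
    by apply: sqr_le_of_norm; rewrite ler_norml; apply/andP; split; lra.
  lra.
rewrite /sqerr reE imE noiseE /sqerr_const.
have := sqr_add3_le (avg (fun i => N i w * ct i)) (avg (fun i => d i * ct i))
  (avg (fun i => gm i * ct i) - coef_re g (kidx b k)).
have := sqr_add3_le (- avg (fun i => N i w * st i)) (- avg (fun i => d i * st i))
  (- avg (fun i => gm i * st i) - coef_im g (kidx b k)).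
rewrite 2!sqrrN; lra.
Qed.

End path.
End pathwise_error.

(** * Independence and integration *)

Section integration_facts.
Context d (T : measurableType d) (R : realType) (P : probability T R).
Implicit Types (U V : T -> R) (A E Z : set T).

Import HBNNSimple.

(* No measurability is assumed: the sample count may fail to be measurable on a null set. *)
Lemma ge0_integral_le_off_null Z (f g : T -> \bar R) : measurable Z -> P Z = 0%E ->
  (forall w, 0 <= f w)%E -> (forall w, 0 <= g w)%E ->
  (forall w, ~ Z w -> f w <= g w)%E ->
  (\int[P]_w f w <= \int[P]_w g w)%E.
Proof.
move=> mZ Z0 f0 g0 fg; rewrite !ge0_integralTE//.
apply: ge_ereal_sup => _ [h /= hf <-].
(* A simple function below [f], cut to zero on [Z], keeps its integral and lies below [g]
   everywhere. *)
pose h' := mul_nnsfun h (indic_nnsfun R (measurableC mZ)).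
have h'E w : h' w = h w * \1_(~` Z) w by [].
apply: ereal_sup_ge; exists (sintegral P h').
  exists h' => // w; rewrite h'E indicE.
  have [wZ|wZ] := pselect (Z w).
    by rewrite memNset ?mulr0//=; apply: contrapT => /(_ wZ).
  by rewrite mem_set// mulr1 (le_trans (hf w))// fg.
rewrite le_eqVlt; apply/orP; left; apply/eqP.
have hE (u : {nnsfun T >-> R}) : sintegral P u = (\int[P]_w (u w)%:E)%E.
  by rewrite integral_nnsfun// patch_setT.
rewrite !hE (ge0_negligible_integral mZ)//; last 2 first.
  exact/measurable_EFinP.
  by move=> w _; rewrite lee_fin.
rewrite [RHS](ge0_negligible_integral mZ)//; last 2 first.
  exact/measurable_EFinP.
  by move=> w _; rewrite lee_fin.
apply: eq_integral => w; rewrite inE => -[_ wZ].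
by rewrite h'E indicE mem_set// mulr1.
Qed.

Lemma bounded_integrable U (c : R) : measurable_fun setT U -> (forall w, `|U w| <= c) ->
  P.-integrable setT (EFin \o U).
Proof.
move=> mU Uc; apply: measurable_bounded_integrable => //.
  by rewrite -ge0_fin_numE// fin_num_measure.
exists c; split; first exact: num_real.
by move=> x cx w _ /=; apply: le_trans (Uc w) (ltW cx).
Qed.

Lemma integrable_mul_of_sqr U V : measurable_fun setT U -> measurable_fun setT V ->
  P.-integrable setT (EFin \o (fun w => U w ^+ 2)) ->
  P.-integrable setT (EFin \o (fun w => V w ^+ 2)) ->
  P.-integrable setT (EFin \o (fun w => U w * V w)).
Proof.
move=> mU mV iU iV.
apply: (@le_integrable _ _ _ P setT measurableT _ (EFin \o (fun w => U w ^+ 2 + V w ^+ 2))).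
- exact/measurable_EFinP/measurable_funM.
- move=> w _ /=; rewrite !lee_fin [leRHS]ger0_norm ?addr_ge0 ?sqr_ge0// normrM.
  rewrite -[U w ^+ 2]real_normK ?num_real// -[V w ^+ 2]real_normK ?num_real//.
  have := sqr_ge0 (`|U w| - `|V w|); have := normr_ge0 (U w); have := normr_ge0 (V w).
  nra.
- by have := integrableD measurableT iU iV; apply: eq_integrable => // w _; rewrite /= EFinD.
Qed.

Lemma integrable_of_sqr U : measurable_fun setT U ->
  P.-integrable setT (EFin \o (fun w => U w ^+ 2)) -> P.-integrable setT (EFin \o U).
Proof.
move=> mU iU; have i1 : P.-integrable setT (EFin \o (fun=> 1 ^+ 2 : R)).
  exact: finite_measure_integrable_cst.
have := integrable_mul_of_sqr mU (@measurable_cst _ _ _ _ setT (1 : R)) iU i1.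
by apply: eq_integrable => // w _ /=; rewrite mulr1.
Qed.

Definition independent_pair U V : Prop := forall B C : set R,
  measurable B -> measurable C ->
  P (U @^-1` B `&` V @^-1` C) = (P (U @^-1` B) * P (V @^-1` C))%E.

(** Independence says that the law of the pair agrees with the product of the two laws on
    rectangles, hence everywhere; Fubini then factors the integral. *)
Lemma independent_pair_integralM U V :
  measurable_fun setT U -> measurable_fun setT V -> independent_pair U V ->
  P.-integrable setT (EFin \o U) -> P.-integrable setT (EFin \o V) ->
  P.-integrable setT (EFin \o (fun w => U w * V w)) ->
  Rintegral P setT (fun w => U w * V w) = Rintegral P setT U * Rintegral P setT V.
Proof.
move=> mU mV UV iU iV iUV.
pose mphi : measurable_fun setT (fun w => (U w, V w)) := measurable_fun_pair mU mV.
pose U' : {mfun T >-> R} := mfun_Sub (mem_set mU).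
pose V' : {mfun T >-> R} := mfun_Sub (mem_set mV).
pose phi : {mfun T >-> (R * R)%type} := mfun_Sub (mem_set mphi).
pose f (z : R * R) : \bar R := (z.1 * z.2)%:E.
have mf : measurable_fun setT f.
  by apply/measurable_EFinP; apply: measurable_funM; [exact: measurable_fst|exact: measurable_snd].
have prodE (A : set (R * R)) : measurable A -> (distribution P U' \x distribution P V')%E A = distribution P phi A.
  apply: product_measure_unique => B C mB mC; rewrite /distribution /pushforward /=.
  by rewrite -(UV B C mB mC); congr (P _); apply/seteqP; split => w.
have iphi : (distribution P phi).-integrable setT f.
  by apply: integrable_pushforward => //; rewrite preimage_setT.
have iprod : (distribution P U' \x distribution P V')%E.-integrable setT f.
  apply/integrableP; split => //; have /integrableP[_] := iphi.
  by apply: le_lt_trans; rewrite le_eqVlt; apply/orP; left; apply/eqP/eq_measure_integral => A mA _; exact: prodE.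
have mid : measurable_fun setT (EFin : R -> \bar R) by exact/measurable_EFinP.
have eU : (\int[distribution P U']_x x%:E = \int[P]_w (U w)%:E)%E.
  exact: (@integral_distribution _ _ _ _ _ P U').
have eV : (\int[distribution P V']_x x%:E = \int[P]_w (V w)%:E)%E.
  exact: (@integral_distribution _ _ _ _ _ P V').
have iVd : (distribution P V').-integrable setT EFin.
  by apply: integrable_pushforward => //; rewrite preimage_setT.
have iUd : (distribution P U').-integrable setT EFin.
  by apply: integrable_pushforward => //; rewrite preimage_setT.
have key : (\int[P]_w (U w * V w)%:E = (\int[P]_w (U w)%:E) * (\int[P]_w (V w)%:E))%E.
  transitivity (\int[distribution P phi]_z f z)%E.
    by rewrite (@integral_distribution _ _ _ _ _ P phi).
  rewrite (eq_measure_integral (distribution P U' \x distribution P V')%E); last first.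
    by move=> A mA _; symmetry; exact: prodE.
  rewrite -integral12_prod_meas1//.
  have inner x : (\int[distribution P V']_y f (x, y) =
      x%:E * (fine (\int[P]_w (V w)%:E))%:E)%E.
    by rewrite /f; under eq_integral do rewrite EFinM; rewrite integralZl// eV fineK ?integrable_fin_num.
  transitivity (\int[distribution P U']_x (x%:E * (fine (\int[P]_w (V w)%:E))%:E))%E.
    by apply: eq_integral => x _; exact: inner.
  by rewrite integralZr// eU fineK ?integrable_fin_num.
by rewrite /Rintegral key fineM ?integrable_fin_num.
Qed.

End integration_facts.

(** * Functions of finitely many coordinates and their independence *)

Section cylinder_sigma_algebra.
Context d (T : measurableType d) (R : realType) (P : probability T R).
Implicit Types (X N : nat -> T -> R) (m : nat) (C E : set T).

Definition cylinder X m (A : nat -> set R) : set T :=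
  \big[setI/setT]_(i <- iota 0 m) (X i @^-1` A i).

(** A pi-system generating the sigma-algebra of X_0, ..., X_{m-1}. Measurability for the generated
    sigma-algebra expresses dependence on the first [m] coordinates only. *)
Definition cylinders X m : set (set T) :=
  [set C | exists2 A : nat -> set R, (forall i, measurable (A i)) & C = cylinder X m A].

Lemma cylinders_setI X m : setI_closed (cylinders X m).
Proof.
move=> _ _ [A mA ->] [B mB ->]; exists (fun i => A i `&` B i).
  by move=> i; exact: measurableI.
by rewrite /cylinder -big_split.
Qed.

Lemma measurable_cylinder X m A : (forall i, measurable_fun setT (X i)) ->
  (forall i, measurable (A i)) -> measurable (cylinder X m A).
Proof.
move=> mX mA; rewrite /cylinder; apply: big_ind => //; first exact: measurableI.
by move=> i _; rewrite -[X in measurable X]setTI; exact: mX.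
Qed.

(** The measures A -> P(A and E) and A -> P(A) P(E) agree on a pi-system and have the same total
    mass, so they agree on the generated sigma-algebra. *)
Lemma independent_of_cylinders X m E : (forall i, measurable_fun setT (X i)) ->
  measurable E ->
  (forall C, cylinders X m C -> P (C `&` E) = (P C * P E)%E) ->
  forall C, <<s cylinders X m >> C -> P (C `&` E) = (P C * P E)%E.
Proof.
move=> mX mE CE C GC.
have PE0 : 0 <= fine (P E) by rewrite fine_ge0.
pose H := [set C' | cylinders X m C' /\ C' `<=` [set: T]].
have HG : H = cylinders X m by apply/seteqP; split => [A []//|A GA]; split.
have mG : H `<=` measurable.
  by rewrite HG => _ [A mA ->]; exact: measurable_cylinder.
have scaleE A : mscale (NngNum PE0) P A = (P A * P E)%E.
  by rewrite /mscale /= fineK ?fin_num_measure// muleC.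
rewrite -scaleE.
apply: (@g_sigma_algebra_measure_unique_trace _ _ _ (cylinders X m) setT measurableT mG _
  (mrestr P mE) (mscale (NngNum PE0) P)) => //.
- by rewrite -/H HG; exact: cylinders_setI.
- by rewrite [RHS]scaleE /= /mrestr setTI probability_setT mul1e.
- by rewrite -/H HG => A GA; rewrite [RHS]scaleE; exact: CE.
- by rewrite /= /mrestr -ge0_fin_numE// fin_num_measure// setTI.
- by rewrite -/H HG.
Qed.

Local Notation sT X m := (g_sigma_algebraType (cylinders X m)).

Lemma measurable_coord X m i : (i < m)%N ->
  measurable_fun (setT : set (sT X m)) (X i).
Proof.
move=> im _ B mB; rewrite setTI; apply: sub_sigma_algebra.
exists (fun j => if j == i then B else setT); first by move=> j; case: ifP.
rewrite /cylinder (bigD1_seq i) ?iota_uniq ?mem_iota//= eqxx.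
by rewrite big1 ?setIT// => j /negbTE ->; rewrite preimage_setT.
Qed.

Lemma measurable_fun_cylinder_fun X m (U : T -> R) : (forall i, measurable_fun setT (X i)) ->
  measurable_fun (setT : set (sT X m)) U -> measurable_fun (setT : set T) U.
Proof.
move=> mX mU _ B mB; have := mU measurableT B mB.
suff : <<s cylinders X m >> `<=` measurable by exact.
apply: smallest_sub; first exact: sigma_algebra_measurable.
by move=> _ [A mA ->]; exact: measurable_cylinder.
Qed.

Lemma independent_pair_of_cylinders X m (U V : T -> R) :
  (forall i, measurable_fun setT (X i)) ->
  measurable_fun (setT : set (sT X m)) U -> measurable_fun setT V ->
  (forall C B, cylinders X m C -> measurable B ->
     P (C `&` V @^-1` B) = (P C * P (V @^-1` B))%E) ->
  independent_pair P U V.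
Proof.
move=> mX mU mV CV B C mB mC.
have mVC : measurable (V @^-1` C) by rewrite -[X in measurable X]setTI; exact: mV.
apply: (@independent_of_cylinders X m _ mX mVC).
  by move=> D GD; exact: CV.
by have := mU measurableT B mB; rewrite setTI.
Qed.

(* Two applications of the pi-lambda argument, one for each family. *)
Lemma independent_pair_of_families X N m l (U V : T -> R) :
  (forall i, measurable_fun setT (X i)) -> (forall i, measurable_fun setT (N i)) ->
  independent_families P X N ->
  measurable_fun (setT : set (sT X m)) U -> measurable_fun (setT : set (sT N l)) V ->
  independent_pair P U V.
Proof.
move=> mX mN XN mU mV.
apply: (independent_pair_of_cylinders mX mU); first exact: measurable_fun_cylinder_fun mV.
move=> _ B [A mA ->] mB; rewrite setIC muleC.
apply: (@independent_of_cylinders N l _ mN (measurable_cylinder m mX mA)).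
  by move=> _ [A' mA' ->]; rewrite setIC muleC; exact: XN.
by have := mV measurableT B mB; rewrite setTI.
Qed.

(** Source of the martingale property: the past, including the stopping indicator, is independent of
    the next spacing. An event on [X m] extends a cylinder of length m to one of length m+1. *)
Lemma independent_pair_next X m (U : T -> R) : (forall i, measurable_fun setT (X i)) ->
  mutually_independent P X ->
  measurable_fun (setT : set (sT X m)) U -> independent_pair P U (X m).
Proof.
move=> mX iX mU; apply: (independent_pair_of_cylinders mX mU) => // _ B [A mA ->] mB.
pose A' i := if i == m then B else A i.
have mA' i : measurable (A' i) by rewrite /A'; case: ifP.
have cylE : cylinder X m A = cylinder X m A'.
  rewrite /cylinder !big_seq; apply: eq_bigr => i; rewrite mem_iota /= add0n => im.
  by rewrite /A' ltn_eqF.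
have -> : cylinder X m A `&` X m @^-1` B = cylinder X m.+1 A'.
  by rewrite cylE /cylinder -addn1 iotaD big_cat /= add0n big_seq1 /A' eqxx.
rewrite cylE /cylinder iX ?iota_uniq// iX ?iota_uniq//.
by rewrite -addn1 iotaD big_cat /= add0n big_seq1 {2}/A' eqxx.
Qed.

Lemma measurable_Ssum X m i : (i <= m)%N -> measurable_fun (setT : set (sT X m)) (Ssum X i).
Proof.
move=> im; apply: (@measurable_sum _ (sT X m)) => j.
by apply: measurable_coord; exact: leq_trans im.
Qed.

Lemma measurable_Ssum_le1 X m i : (i <= m)%N ->
  measurable_fun (setT : set (sT X m)) (fun w => (Ssum X i w <= 1)%R%:R : R).
Proof.
move=> im.
have -> : (fun w : T => (Ssum X i w <= 1)%R%:R) = \1_(Ssum X i @^-1` `]-oo, 1]) :> (T -> R).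
  by apply/funext => w; rewrite indicE; congr (nat_of_bool _)%:R; apply/idP/idP; rewrite inE /= in_itv.
apply: (@measurable_indic _ (sT X m)).
by rewrite -[X in measurable X]setTI; exact: (measurable_Ssum im).
Qed.

Lemma measurable_stopped X m n i : (i <= m)%N ->
  measurable_fun (setT : set (sT X m)) (stopped X n i).
Proof.
move=> im; apply: (@measurable_sum _ (sT X m)) => j.
have jm : (j < m)%N by exact: leq_trans im.
apply: (@measurable_funM _ (sT X m)); last by apply: measurable_Ssum_le1; exact: ltnW.
by apply: (@measurable_funB _ (sT X m)); [exact: measurable_coord|exact: measurable_cst].
Qed.

End cylinder_sigma_algebra.

(** * Second moments of the renewal process and of the noise *)

Section bounded_random_variables.
Context d (T : measurableType d) (R : realType) (P : probability T R).
Implicit Types U V : T -> R.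

(** Spacings are at most lam/n, so all quantities built from finitely many of them are bounded. This
    class is closed under sums and products, unlike integrability. *)
Definition bounded_rv U := measurable_fun setT U /\ exists c, forall w, `|U w| <= c.

Lemma bounded_rv_integrable U : bounded_rv U -> P.-integrable setT (EFin \o U).
Proof. by move=> [mU [c Uc]]; exact: bounded_integrable Uc. Qed.

Lemma bounded_rv_cst (c : R) : bounded_rv (fun=> c).
Proof. by split; [exact: measurable_cst|exists `|c|]. Qed.

Lemma bounded_rvD U V : bounded_rv U -> bounded_rv V -> bounded_rv (fun w => U w + V w).
Proof.
move=> [mU [c Uc]] [mV [c' Vc]]; split; first exact: measurable_funD.
by exists (c + c') => w; apply: le_trans (ler_normD _ _) _; exact: lerD.
Qed.

Lemma bounded_rvM U V : bounded_rv U -> bounded_rv V -> bounded_rv (fun w => U w * V w).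
Proof.
move=> [mU [c Uc]] [mV [c' Vc]]; split; first exact: measurable_funM.
by exists (c * c') => w; rewrite normrM ler_pM.
Qed.

Lemma bounded_rv_sum (I : Type) (s : seq I) (F : I -> T -> R) :
  (forall i, bounded_rv (F i)) -> bounded_rv (fun w => \sum_(i <- s) F i w).
Proof.
move=> bF; elim: s => [|i s IH].
  rewrite (_ : (fun w => _) = (fun=> 0)); first exact: bounded_rv_cst.
  by apply/funext => w; rewrite big_nil.
rewrite (_ : (fun w => _) = (fun w => F i w + \sum_(j <- s) F j w)); first exact: bounded_rvD.
by apply/funext => w; rewrite big_cons.
Qed.

Lemma bounded_rv_indic (A : set T) : measurable A -> bounded_rv \1_A.
Proof.
move=> mA; split; first exact: measurable_indic.
by exists 1 => w; rewrite indicE ger0_norm// lern1; case: (_ \in _).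
Qed.

Lemma RintegralD_bounded U V : bounded_rv U -> bounded_rv V ->
  Rintegral P setT (fun w => U w + V w) = Rintegral P setT U + Rintegral P setT V.
Proof. by move=> bU bV; rewrite RintegralD//; exact: bounded_rv_integrable. Qed.

Lemma RintegralZ_bounded (c : R) U : bounded_rv U ->
  Rintegral P setT (fun w => c * U w) = c * Rintegral P setT U.
Proof. by move=> bU; rewrite RintegralZl//; exact: bounded_rv_integrable. Qed.

Lemma Rintegral_probability_cst (c : R) : Rintegral P setT (fun=> c) = c.
Proof. by rewrite Rintegral_cst// [X in fine X]probability_setT mulr1. Qed.

(** At each point only the term m = [M w] of the series survives; monotone convergence moves the
    series outside. The random index becomes a fixed one on each event. *)
Lemma ge0_integral_nat_partition (M : T -> nat) (F : nat -> T -> \bar R) :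
  (forall m, measurable (M @^-1` [set m])) ->
  (forall m, measurable_fun setT (F m)) -> (forall m w, 0 <= F m w)%E ->
  (\int[P]_w F (M w) w =
   \sum_(m <oo) \int[P]_w ((\1_(M @^-1` [set m]) w)%:E * F m w))%E.
Proof.
move=> mM mF F0.
have t0 m w : (0 <= (\1_(M @^-1` [set m]) w)%:E * F m w)%E by rewrite mule_ge0.
rewrite -integral_nneseries//; last first.
  by move=> m; apply: emeasurable_funM => //; exact/measurable_EFinP/measurable_indic.
apply: eq_integral => w _.
rewrite (@nneseriesD1 _ _ (M w))//= eseries0 => [|m _ mM'].
  by rewrite adde0 indicE mem_set// mul1e.
by rewrite indicE memNset ?mul0e//= => /esym e; rewrite e eqxx in mM'.
Qed.

Lemma measurable_fun_nat_index (M : T -> nat) (F : nat -> T -> R) :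
  (forall m, measurable (M @^-1` [set m])) ->
  (forall m, measurable_fun setT (F m)) -> measurable_fun setT (fun w => F (M w) w).
Proof.
move=> mM mF _ B mB; rewrite setTI.
have -> : (fun w => F (M w) w) @^-1` B = \bigcup_m (M @^-1` [set m] `&` F m @^-1` B).
  apply/seteqP; split => [w Bw|w [m _ [/= <-]]//]; by exists (M w).
apply: bigcup_measurable => m _; apply: measurableI => //.
by rewrite -[X in measurable X]setTI; exact: mF.
Qed.

End bounded_random_variables.

Section renewal_process.
Context d (T : measurableType d) (R : realType) (P : probability T R).
Variables (n lam : R) (X : nat -> T -> R).
Hypotheses (n0 : 0 < n) (lam1 : 1 < lam).
Hypothesis mX : forall i, measurable_fun setT (X i).
Hypothesis iX : mutually_independent P X.
Hypothesis Xb : forall i w, 0 < X i w <= lam / n.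
Hypothesis EX : forall i, Rintegral P setT (X i) = n^-1.

Lemma bounded_rv_spacing i : bounded_rv (X i).
Proof.
split=> //; exists (lam / n) => w; have /andP[h1 h2] := Xb i w.
by rewrite gtr0_norm.
Qed.

Lemma bounded_rv_Ssum_le1 i : bounded_rv (fun w => (Ssum X i w <= 1)%R%:R : R).
Proof.
split; first by apply: (@measurable_fun_cylinder_fun _ _ _ X i) => //; exact: measurable_Ssum_le1.
by exists 1 => w; rewrite ger0_norm// lern1; case: (_ <= _).
Qed.

Lemma bounded_rv_stopped m : bounded_rv (stopped X n m).
Proof.
apply: bounded_rv_sum => i; apply: bounded_rvM; last exact: bounded_rv_Ssum_le1.
by apply: bounded_rvD; [exact: bounded_rv_spacing|exact: bounded_rv_cst].
Qed.

(** Martingale increments are orthogonal: the cross term has mean zero by [independent_pair_next].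
    Each increment adds at most E X^2 <= (lam/n) E X = lam/n^2. *)
Lemma Rintegral_stopped_sqr_le m :
  Rintegral P setT (fun w => stopped X n m w ^+ 2) <= m%:R * (lam / n / n).
Proof.
have n0' := n0; have lam1' := lam1.
elim: m => [|m IH].
  rewrite mul0r (_ : (fun w => _) = (fun=> 0)) ?Rintegral_probability_cst//.
  by apply/funext => w; rewrite /stopped big_ord0 expr2 mul0r.
pose ind w : R := (Ssum X m w <= 1)%R%:R.
pose U w := stopped X n m w * ind w.
have bU : bounded_rv U by apply: bounded_rvM; [exact: bounded_rv_stopped|exact: bounded_rv_Ssum_le1].
have bX := bounded_rv_spacing m.
have bUX : bounded_rv (fun w => U w * X m w) by exact: bounded_rvM.
have bZ2 : bounded_rv (fun w => stopped X n m w ^+ 2).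
  by have := bounded_rv_stopped m => bZ; exact: (bounded_rvM bZ bZ).
have bZ2' : bounded_rv (fun w => stopped X n m.+1 w ^+ 2).
  by have := bounded_rv_stopped m.+1 => bZ; exact: (bounded_rvM bZ bZ).
have bc c V : bounded_rv V -> bounded_rv (fun w : T => c * V w : R).
  by move=> bV; apply: bounded_rvM => //; exact: bounded_rv_cst.
have UX0 : Rintegral P setT (fun w => U w * X m w) = Rintegral P setT U * n^-1.
  rewrite independent_pair_integralM ?EX//; try exact: bounded_rv_integrable.
  - exact: bU.1.
  - apply: independent_pair_next => //.
    by apply: measurable_funM; [exact: measurable_stopped|exact: measurable_Ssum_le1].
have b1 := bounded_rvD (bc (- (2 / n)) _ bU)
  (bounded_rvD (bc (lam / n - 2 / n) _ bX) (bounded_rv_cst T (n^-1 ^+ 2))).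
have b2 := bounded_rvD (bc 2 _ bUX) b1.
(* The indicator is dropped from the squared increment and X^2 is replaced by (lam/n) X, so that the
   bound is linear in [X m] and only its mean is needed. *)
apply: (@le_trans _ _ (Rintegral P setT (fun w => stopped X n m w ^+ 2 +
  (2 * (U w * X m w) + (- (2 / n) * U w +
    ((lam / n - 2 / n) * X m w + n^-1 ^+ 2)))))).
  apply: le_Rintegral => //; [exact: bounded_rv_integrable| |].
    exact/bounded_rv_integrable/(bounded_rvD bZ2 b2).
  move=> w _; rewrite stoppedS /U /ind.
  have /andP[x0 x1] := Xb m w.
  have xx : X m w ^+ 2 <= (lam / n) * X m w by rewrite expr2 ler_wpM2r// ltW.
  have yy : 0 <= (X m w - n^-1) ^+ 2 by exact: sqr_ge0.
  case: (Ssum X m w <= 1); rewrite ?mulr0 ?mulr1 ?addr0 ?add0r; lra.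
rewrite (RintegralD_bounded _ bZ2 b2) (RintegralD_bounded _ (bc _ _ bUX) b1).
rewrite (RintegralD_bounded _ (bc _ _ bU) (bounded_rvD (bc _ _ bX) (bounded_rv_cst T _))).
rewrite (RintegralD_bounded _ (bc _ _ bX) (bounded_rv_cst T _)).
rewrite (RintegralZ_bounded _ _ bUX) (RintegralZ_bounded _ _ bU) (RintegralZ_bounded _ _ bX).
rewrite UX0 EX Rintegral_probability_cst -[m.+1%:R]natr1 [(m%:R + 1) * _]mulrDl mul1r.
apply: lerD => //.
have : 0 <= n^-1 ^+ 2 by exact: sqr_ge0.
lra.
Qed.

Lemma bounded_rv_jitter_bound b K : bounded_rv (fun w => jitter_bound X n lam w b K).
Proof.
have bs i : bounded_rv (fun w => stopped X n i w ^+ 2).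
  by have := bounded_rv_stopped i => bZ; exact: (bounded_rvM bZ bZ).
have bc c V : bounded_rv V -> bounded_rv (fun w : T => c * V w : R).
  by move=> bV; apply: bounded_rvM => //; exact: bounded_rv_cst.
rewrite /jitter_bound; case: (n < lam); first exact: bounded_rv_cst.
apply: bounded_rvD; last exact: (bc).
apply: (bc); apply: bounded_rvD; last exact: (bc).
by apply: (bc); exact: bounded_rv_sum.
Qed.

(** For K <= 3n each second moment is at most 3 lam/n, and the K+1 <= 4n of them sum to at most 12
    lam. In terms of the coefficients of [jitter_bound], 72 = 6 * 12, 9 = 3 * 3 and 12 = 4 * 3. *)
Definition jitter_const (b : nat) : R :=
  (field_lipschitz R b ^+ 2 * (72 * lam ^+ 2 + 9 * lam) + 12 * lam).

Lemma Rintegral_jitter_bound_le b K : K%:R <= 2 * n + 1 ->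
  Rintegral P setT (fun w => jitter_bound X n lam w b K) <= jitter_const b / n.
Proof.
move=> Kn; have n0' := n0; have lam1' := lam1.
have L2 : 0 <= field_lipschitz R b ^+ 2 by exact: sqr_ge0.
rewrite /jitter_bound; have [nlam|nlam] := ltP n lam.
  rewrite Rintegral_probability_cst /jitter_const divr_ge0//; last lra.
  have := sqr_ge0 lam; nra.
have bs i : bounded_rv (fun w => stopped X n i w ^+ 2).
  by have := bounded_rv_stopped i => bZ; exact: (bounded_rvM bZ bZ).
have bc c V : bounded_rv V -> bounded_rv (fun w : T => c * V w : R).
  by move=> bV; apply: bounded_rvM => //; exact: bounded_rv_cst.
have bS : bounded_rv (fun w => \sum_(i < K.+1) stopped X n i w ^+ 2) by exact: bounded_rv_sum.
rewrite (RintegralD_bounded _ (bc _ _ (bounded_rvD (bc _ _ bS) (bc _ _ (bs K)))) (bc _ _ (bs K))).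
rewrite RintegralZ_bounded; last exact: (bounded_rvD (bc _ _ bS) (bc _ _ (bs K))).
rewrite (RintegralD_bounded _ (bc _ _ bS) (bc _ _ (bs K))) !RintegralZ_bounded//.
rewrite Rintegral_sum//; last by move=> i; exact: bounded_rv_integrable.
have v0 : 0 <= lam / n / n by rewrite !divr_ge0//; lra.
(* In this branch n >= lam > 1, which absorbs the additive 1. *)
have K3 : K%:R <= 3 * n by lra.
have EK : Rintegral P setT (fun w => stopped X n K w ^+ 2) <= 3 * (lam / n).
  apply: le_trans (Rintegral_stopped_sqr_le K) _.
  apply: le_trans (ler_wpM2r v0 K3) _.
  by rewrite le_eqVlt; apply/orP; left; apply/eqP; field; rewrite gt_eqF.
have ES : \sum_(i < K.+1) Rintegral P setT (fun w => stopped X n i w ^+ 2) <= 12 * lam.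
  apply: (@le_trans _ _ (\sum_(i < K.+1) 3 * (lam / n))).
    apply: ler_sum => i _; apply: le_trans (Rintegral_stopped_sqr_le i) _.
    have iK : i%:R <= 3 * n by apply: le_trans K3; rewrite ler_nat -ltnS.
    apply: le_trans (ler_wpM2r v0 iK) _.
    by rewrite le_eqVlt; apply/orP; left; apply/eqP; field; rewrite gt_eqF.
  rewrite sumr_const card_ord -[leLHS]mulr_natl -[K.+1%:R]natr1.
  have -> : 12 * lam = 4 * n * (3 * (lam / n)) by field; rewrite gt_eqF.
  apply: ler_wpM2r; last lra.
  by apply: mulr_ge0 => //; apply: divr_ge0; lra.
have -> : jitter_const b / n =
    field_lipschitz R b ^+ 2 * (6 * (lam / n) * (12 * lam) + 3 * (3 * (lam / n)))
    + 4 * (3 * (lam / n)).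
  by rewrite /jitter_const; field; rewrite gt_eqF.
have ln0 : 0 <= lam / n by rewrite divr_ge0//; lra.
apply: lerD; last by rewrite ler_wpM2l.
by rewrite ler_wpM2l// lerD// ler_wpM2l// mulr_ge0.
Qed.

End renewal_process.

Section noise.
Context d (T : measurableType d) (R : realType) (P : probability T R).
Variables (sigma : R) (N : nat -> T -> R).
Hypothesis mN : forall i, measurable_fun setT (N i).
Hypothesis iN : mutually_independent P N.
Hypothesis EN : forall i, ('E_P[N i] = 0)%E.
Hypothesis EN2 : forall i, ('E_P[fun w => (N i w ^+ 2)%R] = (sigma ^+ 2)%:E)%E.

Lemma noise_integrable_sqr i : P.-integrable setT (EFin \o (fun w => N i w ^+ 2)).
Proof.
apply/integrableP; split; first exact/measurable_EFinP/measurable_funX.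
have := EN2 i; rewrite unlock => e.
under eq_integral do rewrite gee0_abs ?lee_fin ?sqr_ge0//.
by rewrite /= e ltry.
Qed.

Lemma noise_integrableM i j : P.-integrable setT (EFin \o (fun w => N i w * N j w)).
Proof. by apply: integrable_mul_of_sqr => //; exact: noise_integrable_sqr. Qed.

Lemma Rintegral_noiseM i j :
  Rintegral P setT (fun w => N i w * N j w) = (i == j)%:R * sigma ^+ 2.
Proof.
have [->|ij] := eqVneq i j.
  by have := EN2 j; rewrite unlock mul1r /Rintegral => ->.
have mean0 k : Rintegral P setT (N k) = 0.
  by have := EN k; rewrite unlock /Rintegral => ->.
have iNk k : P.-integrable setT (EFin \o N k).
  by apply: integrable_of_sqr => //; exact: noise_integrable_sqr.
rewrite independent_pair_integralM//; last exact: noise_integrableM.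
  by rewrite !mean0 mulr0 mul0r.
move=> B C mB mC.
pose A k := if k == i then B else C.
have mA k : measurable (A k) by rewrite /A; case: ifP.
have uij : uniq [:: i; j] by rewrite /= inE ij.
have := iN uij mA; rewrite !big_cons !big_nil setIT mule1 /A eqxx.
by rewrite eq_sym (negbTE ij).
Qed.

(** With theta_i = 2 pi k i/m, the real part of e^(-j theta_i) times the conjugate of e^(-j
    theta_j), over m^2. *)
Definition noise_weight (k : int) (m i j : nat) : R := m%:R^-1 ^+ 2 *
  (cos (2 * pi * k%:~R * i%:R / m%:R) * cos (2 * pi * k%:~R * j%:R / m%:R) +
   sin (2 * pi * k%:~R * i%:R / m%:R) * sin (2 * pi * k%:~R * j%:R / m%:R)).

Lemma noise_sqrE k m : noise_sqr N k m = fun w =>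
  \sum_(i <- index_iota 1 m.+1) \sum_(j <- index_iota 1 m.+1)
    noise_weight k m i j * (N i w * N j w).
Proof.
apply/funext => w; rewrite /noise_sqr !exprMn -mulrDr !expr2 !big_distrlr /=.
rewrite -big_split mulr_sumr; apply: eq_bigr => i _ /=.
rewrite -big_split mulr_sumr; apply: eq_bigr => j _ /=.
by rewrite /noise_weight; ring.
Qed.

Lemma integrable_noise_term k m i j :
  P.-integrable setT (EFin \o (fun w => noise_weight k m i j * (N i w * N j w))).
Proof.
have := integrableZl measurableT (noise_weight k m i j) (noise_integrableM i j).
by apply: eq_integrable => // w _; rewrite /= EFinM.
Qed.

Lemma integrable_noise_sqr k m : P.-integrable setT (EFin \o noise_sqr N k m).
Proof.
rewrite noise_sqrE.
apply: (@eq_integrable _ _ _ P setT measurableT (fun w =>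
  \sum_(i <- index_iota 1 m.+1) \sum_(j <- index_iota 1 m.+1)
    (noise_weight k m i j * (N i w * N j w))%:E)%E).
  by move=> w _ /=; rewrite -sumEFin; apply: eq_bigr => i _; rewrite -sumEFin.
by apply: integrable_sum => // i _; apply: integrable_sum => // j _; exact: integrable_noise_term.
Qed.

(** Independence and zero mean remove the off-diagonal terms; the m diagonal ones give sigma^2/m^2
    each. Both sides vanish at [m = 0]. *)
Lemma Rintegral_noise_sqr k m :
  Rintegral P setT (noise_sqr N k m) = m%:R^-1 * sigma ^+ 2.
Proof.
have iws i : P.-integrable setT (EFin \o (fun w =>
    \sum_(j <- index_iota 1 m.+1) noise_weight k m i j * (N i w * N j w))).
  apply: (@eq_integrable _ _ _ P setT measurableT (fun w =>
    \sum_(j <- index_iota 1 m.+1) (noise_weight k m i j * (N i w * N j w))%:E)%E).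
    by move=> w _ /=; rewrite -sumEFin.
  by apply: integrable_sum => // j _; exact: integrable_noise_term.
rewrite noise_sqrE Rintegral_sum//.
have -> : \sum_(i <- index_iota 1 m.+1) Rintegral P setT (fun w =>
    \sum_(j <- index_iota 1 m.+1) noise_weight k m i j * (N i w * N j w)) =
    \sum_(1 <= i < m.+1) m%:R^-1 ^+ 2 * sigma ^+ 2.
  rewrite big_seq [RHS]big_seq; apply: eq_bigr => i im.
  rewrite Rintegral_sum//; last by move=> j; exact: integrable_noise_term.
  have wE j : Rintegral P setT (fun w => noise_weight k m i j * (N i w * N j w)) =
      noise_weight k m i j * ((i == j)%:R * sigma ^+ 2).
    by rewrite RintegralZl ?Rintegral_noiseM//; exact: noise_integrableM.
  under eq_bigr do rewrite wE.
  rewrite (bigD1_seq i) ?iota_uniq//= eqxx mul1r big1 ?addr0; last first.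
    by move=> j; rewrite eq_sym => /negbTE ->; rewrite mul0r mulr0.
  by rewrite /noise_weight -!expr2 cos2Dsin2 mulr1.
rewrite sumr_const_nat subSS subn0 -[LHS]mulr_natl.
have [->|m0] := eqVneq m 0%N; first by rewrite invr0 !mul0r.
by field; rewrite pnatr_eq0.
Qed.

Lemma measurable_noise_sqr k m :
  measurable_fun (setT : set (g_sigma_algebraType (cylinders N m.+1))) (noise_sqr N k m).
Proof.
have msum (c : nat -> R) : measurable_fun
    (setT : set (g_sigma_algebraType (cylinders N m.+1)))
    (fun w => m%:R^-1 * \sum_(1 <= i < m.+1) N i w * c i).
  apply: measurable_funM; first exact: measurable_cst.
  under eq_fun do rewrite big_nat big_mkcond.
  apply: (@measurable_sum _ (g_sigma_algebraType (cylinders N m.+1))) => i.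
  have [/andP[_ im]|_] := boolP (1 <= i < m.+1)%N; last exact: measurable_cst.
  by apply: measurable_funM; [exact: measurable_coord|exact: measurable_cst].
rewrite /noise_sqr; apply: measurable_funD.
- apply: (@measurable_funX _ (g_sigma_algebraType (cylinders N m.+1))).
  exact: (msum (fun i => cos (2 * pi * k%:~R * i%:R / m%:R))).
- apply: (@measurable_funX _ (g_sigma_algebraType (cylinders N m.+1))).
  exact: (msum (fun i => sin (2 * pi * k%:~R * i%:R / m%:R))).
Qed.

End noise.

(** * Mean square error when the spacing bounds hold on every path *)

Section clean_renewal_process.
Context d (T : measurableType d) (R : realType) (P : probability T R).
Variables (n lam sigma : R) (X N : nat -> T -> R) (M : T -> nat).
Hypotheses (n0 : 0 < n) (lam1 : 1 < lam).
Hypothesis mX : forall i, measurable_fun setT (X i).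
Hypothesis iX : mutually_independent P X.
Hypothesis Xb : forall i w, 0 < X i w <= lam / n.
Hypothesis EX : forall i, Rintegral P setT (X i) = n^-1.
Hypothesis HM : forall w, Ssum X (M w) w <= 1 < Ssum X (M w).+1 w.
Hypothesis mN : forall i, measurable_fun setT (N i).
Hypothesis iN : mutually_independent P N.
Hypothesis EN : forall i, ('E_P[N i] = 0)%E.
Hypothesis EN2 : forall i, ('E_P[fun w => (N i w ^+ 2)%R] = (sigma ^+ 2)%:E)%E.
Hypothesis XN : independent_families P X N.

(** Positive spacings make the sums increase, so the crossing of 1 is unique. Hence [M = m] is an
    event of the first m+1 spacings, which gives both measurability of [M] and its independence from
    the noise. *)
Lemma samples_eqE m w : (M w == m) = (Ssum X m w <= 1) && ~~ (Ssum X m.+1 w <= 1).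
Proof.
have homo := @Ssum_homo R T X n lam w (fun i => Xb i w).
have /andP[h1 h2] := HM w; rewrite -ltNge.
apply/eqP/andP => [<- //|[h3 h4]]; apply/eqP; rewrite eqn_leq; apply/andP; split.
  rewrite leqNgt; apply/negP => mM.
  by have := lt_le_trans h4 (homo _ _ mM); rewrite ltNge h1.
rewrite leqNgt; apply/negP => mM.
by have := lt_le_trans h2 (homo _ _ mM); rewrite ltNge h3.
Qed.

Lemma samples_indicE m : \1_(M @^-1` [set m]) = (fun w =>
  (Ssum X m w <= 1)%R%:R * (1 - (Ssum X m.+1 w <= 1)%R%:R)) :> (T -> R).
Proof.
apply/funext => w; rewrite indicE.
have -> : (w \in M @^-1` [set m]) = (M w == m) by apply/idP/eqP; rewrite inE.
rewrite samples_eqE.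
by case: (Ssum X m w <= 1); case: (Ssum X m.+1 w <= 1); rewrite /= ?mul0r ?mul1r ?subr0 ?subrr.
Qed.

Lemma measurable_samples_indic m :
  measurable_fun (setT : set (g_sigma_algebraType (cylinders X m.+1)))
    (\1_(M @^-1` [set m]) : T -> R).
Proof.
rewrite samples_indicE; apply: measurable_funM; first exact: measurable_Ssum_le1.
by apply: measurable_funB; [exact: measurable_cst|exact: measurable_Ssum_le1].
Qed.

Lemma measurable_samples m : measurable (M @^-1` [set m]).
Proof.
have /(_ measurableT [set 1] (measurable_set1 _)) :=
  measurable_fun_cylinder_fun mX (measurable_samples_indic (m := m)).
rewrite setTI; congr measurable; apply/seteqP; split => w /=; rewrite indicE.
  by case: (boolP (w \in _)); rewrite ?inE// => _ /esym/eqP; rewrite oner_eq0.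
by move=> h; rewrite mem_set.
Qed.

Lemma measurable_noise_sqr_samples k :
  measurable_fun setT (fun w => noise_sqr N k (M w) w).
Proof.
apply: (measurable_fun_nat_index measurable_samples) => m.
by apply: (@measurable_fun_cylinder_fun _ _ _ N m.+1) => //; exact: measurable_noise_sqr.
Qed.

(** On [M = m] the indicator depends on the spacings and the averaged noise on the readings, so the
    expectation factors as P(M = m) sigma^2/m. The constant bound is split over the same events and
    compared term by term. *)
Lemma integral_noise_sqr_samples_le k :
  (\int[P]_w (noise_sqr N k (M w) w)%:E <= (sigma ^+ 2 * (2 * (lam / n)))%:E)%E.
Proof.
have n0' := n0; have lam1' := lam1.
have ns0 m w : 0 <= noise_sqr N k m w by rewrite addr_ge0// sqr_ge0.
have mns m : measurable_fun setT (noise_sqr N k m).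
  by apply: (@measurable_fun_cylinder_fun _ _ _ N m.+1) => //; exact: measurable_noise_sqr.
have c0 : 0 <= sigma ^+ 2 * (2 * (lam / n)).
  by rewrite mulr_ge0 ?sqr_ge0// mulr_ge0// divr_ge0//; lra.
set c := sigma ^+ 2 * _ in c0 *.
rewrite (ge0_integral_nat_partition P (F := fun m w => (noise_sqr N k m w)%:E)
  measurable_samples); last 2 first.
- by move=> m; exact/measurable_EFinP.
- by move=> m w; rewrite lee_fin.
have cE : (\int[P]_w c%:E)%E = c%:E.
  by rewrite integral_cst// [X in (_ * X)%E]probability_setT mule1.
rewrite -[leRHS]cE (ge0_integral_nat_partition P (F := fun _ _ => c%:E)
  measurable_samples)//.
apply: lee_nneseries => [m _ _|m _].
  by apply: integral_ge0 => w _; rewrite mule_ge0// lee_fin.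
pose I : T -> R := \1_(M @^-1` [set m]).
have mI : measurable (M @^-1` [set m]) := measurable_samples m.
have bI : bounded_rv I by exact: bounded_rv_indic.
have iI := bounded_rv_integrable P bI.
have iS := integrable_noise_sqr mN EN2 k m.
have iIS : P.-integrable setT (EFin \o (fun w => I w * noise_sqr N k m w)).
  apply: le_integrable iS => //.
    by apply/measurable_EFinP/measurable_funM => //; exact: bI.1.
  move=> w _; rewrite /= lee_fin normrM ler_piMl// /I indicE ger0_norm// lern1.
  by case: (_ \in _).
have -> : (\int[P]_w ((\1_(M @^-1` [set m]) w)%:E * (noise_sqr N k m w)%:E))%E =
    (Rintegral P setT I * Rintegral P setT (noise_sqr N k m))%:E.
  rewrite -independent_pair_integralM//; [|exact: bI.1|].
    by rewrite /Rintegral fineK//; exact: integrable_fin_num.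
  apply: (@independent_pair_of_families _ _ _ P X N m.+1 m.+1) => //.
    exact: measurable_samples_indic.
  exact: measurable_noise_sqr.
have -> : (\int[P]_w ((\1_(M @^-1` [set m]) w)%:E * c%:E))%E = (Rintegral P setT I * c)%:E.
  rewrite integralZr// EFinM; congr (_ * _)%E.
  by rewrite /Rintegral fineK//; exact: integrable_fin_num.
rewrite lee_fin (Rintegral_noise_sqr mN iN EN EN2).
have I0 : 0 <= Rintegral P setT I by apply: Rintegral_ge0 => w _.
(* The bound 1/m <= 2 lam/n is read off a path with m samples; if there is none, the indicator is
   zero. *)
have [[w Mw]|none] := pselect (exists w, M w = m).
  apply: ler_wpM2l => //; rewrite mulrC; apply: ler_wpM2l; first exact: sqr_ge0.
  rewrite -Mw; apply: (inv_samples_le n0 lam1 (X := X)) => //.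
have -> : Rintegral P setT I = 0.
  rewrite (_ : I = (fun=> 0)) ?Rintegral_probability_cst//.
  by apply/funext => w; rewrite /I indicE memNset//= => Mw; apply: none; exists w.
by rewrite !mul0r.
Qed.

Lemma measurable_sqerr b g (k : int) : bandlimited b g ->
  measurable_fun setT (sqerr g X N M k).
Proof.
move=> gb.
have cg := continuous_bandlimited gb.
have mg : measurable_fun setT g by exact: continuous_measurable_fun.
have mS i : measurable_fun setT (Ssum X i).
  by apply: measurable_sum => j; exact: mX.
have msum m (c : nat -> R) : measurable_fun setT
    (fun w => m%:R^-1 * \sum_(1 <= i < m.+1) (g (Ssum X i w) + N i w) * c i).
  apply: measurable_funM; first exact: measurable_cst.
  apply: measurable_sum => i; apply: measurable_funM; last exact: measurable_cst.
  by apply: measurable_funD => //; exact: (measurableT_comp mg).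
have -> : sqerr g X N M k = (fun w => sqerr g X N (fun=> M w) k w) by [].
apply: (measurable_fun_nat_index (F := fun m => sqerr g X N (fun=> m) k) measurable_samples) => m.
apply: measurable_funD; apply: measurable_funX; apply: measurable_funB => //.
  exact: (msum m (fun i => cos (2 * pi * k%:~R * i%:R / m%:R))).
exact/measurableT_comp/(msum m (fun i => sin (2 * pi * k%:~R * i%:R / m%:R))).
Qed.

Definition mse_const (b : nat) : R :=
  6 * sigma ^+ 2 * lam + 3 * jitter_const lam b + sqerr_const R b * lam.

Lemma expectation_sqerr_le b g (k : 'I_(2 * b + 1)) :
  bandlimited b g -> (forall x, `|g x| <= 1) ->
  ('E_P[sqerr g X N M (kidx b k)] <= (mse_const b / n)%:E)%E.
Proof.
move=> gb g1; have n0' := n0; have lam1' := lam1.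
(* The integer part of 2n plus 1 meets both demands on K: 2n <= K for [sqerr_le] and K <= 2n + 1 for
   the moment bound. *)
pose K := (Num.truncn (2 * n)).+1.
have nK : 2 * n <= K%:R by exact/ltW/truncnS_gt.
have Kn : K%:R <= 2 * n + 1.
  by rewrite /K -natr1 lerD2r truncn_le// mulr_ge0// ltW.
pose J w := jitter_bound X n lam w b K.
pose c := sqerr_const R b * (lam / n).
have c0 : 0 <= c.
  rewrite mulr_ge0 ?divr_ge0//; [|lra|lra].
  by rewrite /sqerr_const !addr_ge0// mulr_ge0// sqr_ge0.
have J0 w : 0 <= J w.
  rewrite /J /jitter_bound; case: ifP => // _.
  have s0 : 0 <= \sum_(i < K.+1) stopped X n i w ^+ 2.
    by apply: sumr_ge0 => i _; exact: sqr_ge0.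
  have L2 : 0 <= field_lipschitz R b ^+ 2 by exact: sqr_ge0.
  have Z2 : 0 <= stopped X n K w ^+ 2 by exact: sqr_ge0.
  have ln0 : 0 <= lam / n by rewrite divr_ge0//; lra.
  by rewrite addr_ge0// mulr_ge0// addr_ge0// mulr_ge0// mulr_ge0.
have ns0 w : 0 <= noise_sqr N (kidx b k) (M w) w by rewrite addr_ge0// sqr_ge0.
have bJ : bounded_rv J by exact: bounded_rv_jitter_bound.
have bJc : bounded_rv (fun w => 3 * J w + c).
  apply: bounded_rvD; last exact: bounded_rv_cst.
  by apply: bounded_rvM => //; exact: bounded_rv_cst.
rewrite unlock.
apply: (@le_trans _ _ (\int[P]_w (3%:E * (noise_sqr N (kidx b k) (M w) w)%:E +
    (3 * J w + c)%:E))%E).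
  apply: (@ge0_integral_le_off_null _ _ _ P set0) => //.
  - by move=> w; rewrite lee_fin addr_ge0// sqr_ge0.
  - move=> w; rewrite -EFinM -EFinD lee_fin.
    by rewrite addr_ge0// ?mulr_ge0// addr_ge0// mulr_ge0.
  - move=> w _; rewrite -EFinM -EFinD lee_fin addrA.
    exact: (sqerr_le n0 lam1 (fun i => Xb i w) (HM w) gb g1).
rewrite ge0_integralD//; last 4 first.
- by move=> w _; rewrite -EFinM lee_fin mulr_ge0.
- by apply: emeasurable_funM => //; exact/measurable_EFinP/measurable_noise_sqr_samples.
- by move=> w _; rewrite lee_fin addr_ge0// mulr_ge0.
- by apply/measurable_EFinP; exact: bJc.1.
rewrite ge0_integralZl//; last 2 first.
- exact/measurable_EFinP/measurable_noise_sqr_samples.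
- by move=> w _; rewrite lee_fin.
have EJ : (\int[P]_w (3 * J w + c)%:E <= (3 * (jitter_const lam b / n) + c)%:E)%E.
  rewrite -[leLHS]fineK; last exact/integrable_fin_num/bounded_rv_integrable.
  rewrite lee_fin -[leLHS]/(Rintegral P setT (fun w => 3 * J w + c)).
  rewrite (RintegralD_bounded _ _ (bounded_rv_cst T c)); last first.
    by apply: bounded_rvM => //; exact: bounded_rv_cst.
  rewrite (RintegralZ_bounded _ _ bJ) Rintegral_probability_cst lerD2r ler_wpM2l//.
  exact: Rintegral_jitter_bound_le.
have -> : (mse_const b / n)%:E = (3%:E * (sigma ^+ 2 * (2 * (lam / n)))%:E +
    (3 * (jitter_const lam b / n) + c)%:E)%E.
  rewrite -EFinM -EFinD; congr EFin; rewrite /mse_const /c; field.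
  by rewrite gt_eqF.
apply: leeD => //; apply: lee_wpmul2l; first by rewrite lee_fin.
exact: integral_noise_sqr_samples_le.
Qed.

End clean_renewal_process.

(** * Removing the exceptional null set *)

Section spacings_on_null_set.
Context d (T : measurableType d) (R : realType) (P : probability T R).
Variables (n lam : R) (X : nat -> T -> R) (M : T -> nat).
Hypotheses (n0 : 0 < n) (lam1 : 1 < lam).
Hypothesis mX : forall i, measurable_fun setT (X i).
Hypothesis dX : identically_distributed P X.
Hypothesis X0b : P (X 0%N @^-1` `]0, lam / n]) = 1%E.

Definition good_paths : set T := \bigcap_i (X i @^-1` `]0, lam / n]).

Lemma measurable_good_paths : measurable good_paths.
Proof.
apply: bigcap_measurable => // i _; rewrite -[X in measurable X]setTI.
exact: mX.
Qed.

Lemma null_bad_paths : P (~` good_paths) = 0%E.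
Proof.
have mi i : measurable (X i @^-1` `]0, lam / n]).
  by rewrite -[X in measurable X]setTI; exact: mX.
have Pi i : P (~` (X i @^-1` `]0, lam / n])) = 0%E.
  by rewrite probability_setC// (dX i 0%N)// X0b subee.
apply/eqP; rewrite eq_le measure_ge0 andbT /good_paths setC_bigcap.
apply: le_trans (generalized_Boole_inequality _ _ _) _.
- by move=> i; exact: measurableC.
- by apply: bigcup_measurable => i _; exact: measurableC.
- by rewrite eseries0// => i _ _; exact: Pi.
Qed.

(** Bad paths form a null set; this carries laws and independence over to the modified spacings. *)
Lemma measure_eq_on_good (A B : set T) : measurable A -> measurable B ->
  A `&` good_paths = B `&` good_paths -> P A = P B.
Proof.
have mG := measurable_good_paths.
have onG C : measurable C -> P C = P (C `&` good_paths).
  move=> mC; rewrite (measureDI P mC mG) [X in (X + _)%E](_ : _ = 0%E) ?add0e//.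
  apply/eqP; rewrite eq_le measure_ge0 andbT -null_bad_paths.
  by apply: le_measure; rewrite ?inE; [exact: measurableD|exact: measurableC|move=> w []].
by move=> mA mB AB; rewrite onG// [RHS]onG// AB.
Qed.

(* On the null set of bad paths the spacings become constant, so that the
   renewal process still leaves [0, 1] and a sample count still exists. *)
Definition clean_spacing (i : nat) (w : T) : R :=
  if w \in good_paths then X i w else lam / n.

Definition clean_samples (w : T) : nat :=
  if w \in good_paths then M w else Num.truncn (n / lam).

Lemma clean_spacing_good i w : good_paths w -> clean_spacing i w = X i w.
Proof. by move=> gw; rewrite /clean_spacing mem_set. Qed.

Lemma Ssum_clean_good i w : good_paths w -> Ssum clean_spacing i w = Ssum X i w.
Proof. by move=> gw; apply: eq_bigr => j _; exact: clean_spacing_good. Qed.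

Lemma clean_samples_good w : good_paths w -> clean_samples w = M w.
Proof. by move=> gw; rewrite /clean_samples mem_set. Qed.

Lemma clean_spacing_bounds i w : 0 < clean_spacing i w <= lam / n.
Proof.
rewrite /clean_spacing; case: ifPn => [|_].
  by rewrite inE => /(_ i I) /=; rewrite in_itv.
by rewrite lexx andbT divr_gt0//; exact: lt_trans lam1.
Qed.

Lemma clean_samplesP : (forall w, Ssum X (M w) w <= 1 < Ssum X (M w).+1 w) ->
  forall w, Ssum clean_spacing (clean_samples w) w <= 1 <
            Ssum clean_spacing (clean_samples w).+1 w.
Proof.
move=> HM w; have lam0 : 0 < lam by exact: lt_trans lam1.
have [gw|bw] := pselect (good_paths w).
  by rewrite !Ssum_clean_good// clean_samples_good.
have SE i : Ssum clean_spacing i w = i%:R * (lam / n).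
  rewrite /Ssum /clean_spacing memNset// sumr_const card_ord mulr_natl//.
rewrite !SE /clean_samples memNset//.
have q0 : 0 <= n / lam by rewrite divr_ge0// ltW.
(* On a bad path all spacings equal lam/n, and n/lam of them fill [0, 1] exactly, so the integer
   part of n/lam is the sample count. *)
have qE : 1 = n / lam * (lam / n) by field; rewrite !gt_eqF.
apply/andP; split.
  by rewrite [leRHS]qE ler_wpM2r ?truncn_le// ltW// divr_gt0.
by rewrite [ltLHS]qE ltr_pM2r ?divr_gt0// truncnS_gt.
Qed.

Lemma measurable_clean_spacing i : measurable_fun setT (clean_spacing i).
Proof.
apply: measurable_fun_ifT => //.
apply: (measurable_fun_bool true).
rewrite setTI (_ : _ @^-1` _ = good_paths); first exact: measurable_good_paths.
by apply/seteqP; split => w /= h; [exact: set_mem|exact: mem_set].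
Qed.

Lemma preimage_clean_spacing i (B : set R) :
  clean_spacing i @^-1` B `&` good_paths = X i @^-1` B `&` good_paths.
Proof. by apply/seteqP; split => w [/= h gw]; split; rewrite // clean_spacing_good in h *. Qed.

Lemma cylinder_clean_spacing (J : seq nat) (B : nat -> set R) :
  \big[setI/setT]_(i <- J) (clean_spacing i @^-1` B i) `&` good_paths =
  \big[setI/setT]_(i <- J) (X i @^-1` B i) `&` good_paths.
Proof.
elim: J => [|i J IH]; first by rewrite !big_nil.
by rewrite !big_cons setIIl IH preimage_clean_spacing -setIIl.
Qed.

Lemma measurable_preimage (Y : T -> R) (B : set R) : measurable_fun setT Y ->
  measurable B -> measurable (Y @^-1` B).
Proof. by move=> mY mB; rewrite -[X in measurable X]setTI; exact: mY. Qed.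

Lemma measurable_preimages (Y : nat -> T -> R) (J : seq nat) (B : nat -> set R) :
  (forall i, measurable_fun setT (Y i)) -> (forall i, measurable (B i)) ->
  measurable (\big[setI/setT]_(i <- J) (Y i @^-1` B i)).
Proof.
move=> mY mB; apply: big_ind => //; first exact: measurableI.
by move=> i _; exact: measurable_preimage.
Qed.

Lemma mutually_independent_clean : mutually_independent P X ->
  mutually_independent P clean_spacing.
Proof.
move=> iX J B uJ mB; have mC := measurable_clean_spacing.
rewrite (measure_eq_on_good _ _ (cylinder_clean_spacing J B)); try exact: measurable_preimages.
rewrite iX//; apply: eq_bigr => i _; symmetry.
by apply: measure_eq_on_good; [exact: measurable_preimage|exact: measurable_preimage|
  exact: preimage_clean_spacing].
Qed.

Lemma independent_families_clean (N : nat -> T -> R) :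
  (forall i, measurable_fun setT (N i)) -> independent_families P X N ->
  independent_families P clean_spacing N.
Proof.
move=> mN XN K L A B mA mB; have mC := measurable_clean_spacing.
rewrite (measure_eq_on_good _ _ (cylinder_clean_spacing K A)); try exact: measurable_preimages.
rewrite -XN//; apply: measure_eq_on_good.
- by apply: measurableI; exact: measurable_preimages.
- by apply: measurableI; exact: measurable_preimages.
- by rewrite setIAC cylinder_clean_spacing setIAC.
Qed.

(** The mean is prescribed for [X 0] alone and spreads through equality of laws. The argument runs
    on the modified spacings because boundedness makes them integrable. *)
Lemma Rintegral_clean_spacing (c : R) : ('E_P[X 0%N] = c%:E)%E ->
  forall i, Rintegral P setT (clean_spacing i) = c.
Proof.
move=> EX i; have mC := measurable_clean_spacing.
have bC j : P.-integrable setT (EFin \o clean_spacing j).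
  apply: (@bounded_integrable _ _ _ P _ (lam / n)) => // w.
  by have /andP[h1 h2] := clean_spacing_bounds j w; rewrite gtr0_norm.
have EFinm : measurable_fun setT (EFin : R -> \bar R) by exact/measurable_EFinP.
pose C j : {mfun T >-> R} := mfun_Sub (mem_set (mC j)).
have distE j : (\int[distribution P (C j)]_x x%:E = \int[P]_w (clean_spacing j w)%:E)%E.
  exact: (@integral_distribution _ _ _ _ _ P (C j) EFin EFinm (bC j)).
have -> : Rintegral P setT (clean_spacing i) = Rintegral P setT (clean_spacing 0%N).
  rewrite /Rintegral -!distE; congr fine; apply: eq_measure_integral => B mB _.
  rewrite /= /distribution /pushforward /=.
  have onX j : P (clean_spacing j @^-1` B) = P (X j @^-1` B).
    by apply: measure_eq_on_good; [exact: measurable_preimage|exact: measurable_preimage|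
      exact: preimage_clean_spacing].
  by transitivity (P (X i @^-1` B)); [exact: onX|rewrite (dX i 0%N)//; symmetry; exact: onX].
move: EX; rewrite unlock /Rintegral => EX.
have -> : (\int[P]_w (clean_spacing 0 w)%:E = \int[P]_w (X 0%N w)%:E)%E; last by rewrite EX.
apply: ae_eq_integral => //; [exact/measurable_EFinP|exact/measurable_EFinP|].
exists (~` good_paths); split.
- exact/measurableC/measurable_good_paths.
- exact: null_bad_paths.
- by move=> w /= nw gw; apply: nw => _; rewrite clean_spacing_good.
Qed.

Lemma sqerr_clean_good (g : R -> R) (N : nat -> T -> R) (k : int) w : good_paths w ->
  sqerr g clean_spacing N clean_samples k w = sqerr g X N M k w.
Proof.
move=> gw; rewrite /sqerr /Ahat_re /Ahat_im clean_samples_good//.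
by under eq_bigr do rewrite Ssum_clean_good//; under [in X in _ + X]eq_bigr do rewrite Ssum_clean_good//.
Qed.

Lemma ge0_integral_eq_on_good (f h : T -> \bar R) :
  (forall w, 0 <= f w)%E -> (forall w, 0 <= h w)%E ->
  (forall w, good_paths w -> f w = h w) -> (\int[P]_w f w = \int[P]_w h w)%E.
Proof.
move=> f0 h0 fh; have mZ := measurableC measurable_good_paths.
apply/eqP; rewrite eq_le; apply/andP; split;
  apply: (ge0_integral_le_off_null mZ null_bad_paths) => // w /contrapT gw.
  by rewrite fh.
by rewrite fh.
Qed.

End spacings_on_null_set.

(** * Transfer to the original process and the distortion bound *)

Unset Implicit Arguments.

Theorem theorem1 (R : realType) (b : nat) (lam sigma : R) :
  (0 < b)%N -> 1 < lam -> 0 <= sigma ->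
  exists C : R,
  forall (d : measure_display) (T : measurableType d) (P : probability T R)
    (n : R) (g : R -> R) (X N : nat -> T -> R) (M : T -> nat),
    0 < n ->
    (* g: 1-periodic, bounded by 1, bandlimited with bandwidth b *)
    (forall x, g (x + 1) = g x) ->
    (forall x, `|g x| <= 1) ->
    bandlimited b g ->
    (* renewal process: i.i.d. spacings, mean 1/n, support in (0, lam/n] *)
    (forall i, measurable_fun setT (X i)) ->
    mutually_independent P X ->
    identically_distributed P X ->
    ('E_P[X 0%N] = (n^-1)%:E)%E ->
    P (X 0%N @^-1` `]0, lam / n]) = 1%E ->
    (* M = number of samples in [0,1] : S_M <= 1 < S_{M+1} *)
    (forall w, Ssum X (M w) w <= 1 < Ssum X (M w).+1 w) ->
    (* noise readings N i = W(S_i): i.i.d., zero mean, variance sigma^2,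
       independent of the spacings *)
    (forall i, measurable_fun setT (N i)) ->
    mutually_independent P N ->
    identically_distributed P N ->
    (forall i, 'E_P[N i] = 0%E)%E ->
    (forall i, 'E_P[fun w => (N i w ^+ 2)%R] = (sigma ^+ 2)%:E)%E ->
    independent_families P X N ->
    (forall i : 'I_(2 * b + 1),
       ('E_P[sqerr g X N M (kidx b i)] <= (C / n)%:E)%E) /\
    (\int[P]_w (\int[lebesgue_measure]_(x in `[0%R, 1%R]) (recon_sqerr b g X N M w x)%:E)
       = \sum_(i < 2 * b + 1) 'E_P[sqerr g X N M (kidx b i)])%E /\
    (\int[P]_w (\int[lebesgue_measure]_(x in `[0%R, 1%R]) (recon_sqerr b g X N M w x)%:E)
       <= ((2 * b + 1)%:R * C / n)%:E)%E.
Proof.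
(* The witness is built from lam, sigma and b only, before the probability space, the rate n and the
   field g are introduced. *)
move=> _ lam1 _; exists (mse_const lam sigma b).
move=> d T P n g X N M n0 _ g1 gb mX iX dX EX X0b HM mN iN _ EN EN2 XN.
pose X' := clean_spacing n lam X; pose M' := clean_samples n lam X M.
have mX' i : measurable_fun setT (X' i) by exact: measurable_clean_spacing.
have iX' : mutually_independent P X' by exact: mutually_independent_clean.
have Xb' i w : 0 < X' i w <= lam / n by exact: clean_spacing_bounds.
have EX' i : Rintegral P setT (X' i) = n^-1 by exact: Rintegral_clean_spacing.
have HM' w : Ssum X' (M' w) w <= 1 < Ssum X' (M' w).+1 w by exact: clean_samplesP.
have XN' : independent_families P X' N by exact: independent_families_clean.
have sqerr0 Y S k w : 0 <= sqerr g Y N S k w by rewrite addr_ge0// sqr_ge0.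
have sqerrE k w : good_paths n lam X w -> sqerr g X N M k w = sqerr g X' N M' k w.
  by move=> gw; rewrite sqerr_clean_good.
have EsqerrE k : ('E_P[sqerr g X N M k] = 'E_P[sqerr g X' N M' k])%E.
  rewrite unlock; apply: (ge0_integral_eq_on_good mX dX X0b) => [w|w|w gw].
  - by rewrite lee_fin.
  - by rewrite lee_fin.
  - by rewrite sqerrE.
have mse (i : 'I_(2 * b + 1)) : ('E_P[sqerr g X N M (kidx b i)] <= (mse_const lam sigma b / n)%:E)%E.
  rewrite EsqerrE.
  exact: (expectation_sqerr_le n0 lam1 mX' iX' Xb' EX' HM' mN iN EN EN2 XN' i gb g1).
have distortion : (\int[P]_w (\int[lebesgue_measure]_(x in `[0%R, 1%R])
      (recon_sqerr b g X N M w x)%:E) =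
    \sum_(i < 2 * b + 1) 'E_P[sqerr g X N M (kidx b i)])%E.
  (* The inner integral is evaluated exactly on each path, so no exchange of the two integrals is
     involved. *)
  under eq_integral do rewrite integral_recon_sqerr//.
  (* Taking the finite sum out of the integral requires measurable terms, which the modified process
     provides. *)
  transitivity (\int[P]_w (\sum_(i < 2 * b + 1) (sqerr g X' N M' (kidx b i) w)%:E))%E.
    apply: (ge0_integral_eq_on_good mX dX X0b) => [w|w|w gw].
    - by rewrite lee_fin sumr_ge0.
    - by apply: sume_ge0 => i _; rewrite lee_fin.
    - by rewrite -sumEFin; apply: eq_bigr => i _; rewrite sqerrE.
  rewrite ge0_integral_sum//; last 2 first.
  - by move=> i; apply/measurable_EFinP; apply: (measurable_sqerr mX' Xb' HM' mN (kidx b i) gb).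
  - by move=> i w _; rewrite lee_fin.
  by apply: eq_bigr => i _; rewrite EsqerrE unlock.
split => //; split => //.
rewrite distortion; apply: (@le_trans _ _ (\sum_(i < 2 * b + 1) (mse_const lam sigma b / n)%:E)%E).
  exact: lee_sum.
by rewrite sumEFin lee_fin sumr_const card_ord -mulrA mulr_natl.
Qed.
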